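(* Consider the problem, assumptions and algorithm (SDBGD) described in the context. Given a horizon $K\ge1$, run SDBGD for $K$ iterations with the constant parameters $$\eta_k\equiv\eta\propto K^{-1/4}\in\big(0,(2L_f+4L_g)^{-1}\big),\quad \beta_k\equiv\beta\propto\eta^{-3}K^{-1}\in(0,1),\quad \rho_k\equiv\rho\propto\eta^{-2}K^{-2},$$ $$B_{f,k}\equiv B_f\propto\eta^4K^2,\quad B_{g,k}\equiv B_g\propto\eta^6K^4,$$ where all proportionality constants are independent of $K$. Under this schedule, the method reaches an $(\varepsilon,\varepsilon)$-stationary point in $\mathcal O(\varepsilon^{-2})$ iterations, resulting in $\mathcal O(\varepsilon^{-4})$ upper-level stochastic oracle calls (evaluations of $\nabla f_\xi$) and $\mathcal O(\varepsilon^{-7})$ lower-level stochastic oracle calls (evaluations of $\nabla g_\zeta$).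
   Context: Problem and assumptions. $\mathcal H$ is a real Hilbert space with inner product $\langle\cdot,\cdot\rangle$ and induced norm $\|\cdot\|$. The problem is $\min_{x\in\mathcal H}\{f(x): x\in\operatorname{argmin} g\}$, where for all $x\in\mathcal H$, $f(x)=\mathbb E_\xi[f_\xi(x)]$ and $g(x)=\mathbb E_\zeta[g_\zeta(x)]$, with $f_\xi,g_\zeta:\mathcal H\to\mathbb R$ stochastic realizations of $f$ and $g$. The expectations defining $f$ and $g$ are well defined and differentiable, with $\nabla f(x)=\mathbb E_\xi[\nabla f_\xi(x)]$ and $\nabla g(x)=\mathbb E_\zeta[\nabla g_\zeta(x)]$ for all $x$; moreover $\operatorname{argmin} g\neq\emptyset$ and $\inf f>-\infty$. There exist constants $L_f,L_g,G_f>0$ and $\sigma_f^2,\sigma_g^2\ge0$ such that: $f$ and $g$ are respectively $L_f$- and $L_g$-smooth (gradients Lipschitz with these constants); $\|\nabla f(x)\|\le G_f$ for all $x\in\mathcal H$; and $\mathbb E_\xi\|\nabla f_\xi(x)-\nabla f(x)\|^2\le\sigma_f^2$, $\mathbb E_\zeta\|\nabla g_\zeta(x)-\nabla g(x)\|^2\le\sigma_g^2$ for all $x\in\mathcal H$. Neither $f$ nor $g$ is assumed convex. Stationarity. A point $x\in\mathcal H$ is $(\varepsilon_f,\varepsilon_g)$-stationary if there exists $\lambda\ge0$ satisfying $\|\nabla f(x)+\lambda\nabla g(x)\|^2\le\varepsilon_f$ and $\|\nabla g(x)\|^2\le\varepsilon_g$. Algorithm (SDBGD), with step-sizes $\eta_k>0$,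 barrier parameters $\beta_k>0$, regularization parameters $\rho_k>0$, batch-sizes $B_{f,k},B_{g,k}\ge1$, and initial point $x_0$. For $k=0,\dots,K-1$: draw independent samples $\xi_{k,i}$, $i=1,\dots,B_{f,k}$, and $\zeta_{k,j}$, $j=1,\dots,B_{g,k}$; form the independent mini-batch estimators $\nabla f_k=\frac1{B_{f,k}}\sum_{i=1}^{B_{f,k}}\nabla f_{\xi_{k,i}}(x_k)$ and $\nabla g_k=\frac1{B_{g,k}}\sum_{j=1}^{B_{g,k}}\nabla g_{\zeta_{k,j}}(x_k)$; compute $\hat\lambda_k=\dfrac{[\beta_k\|\nabla g_k\|^2-\langle\nabla f_k,\nabla g_k\rangle]_+}{\|\nabla g_k\|^2+\rho_k}$, where $[t]_+=\max(t,0)$; compute $\hat d_k=\nabla f_k+\hat\lambda_k\nabla g_k$; and update $x_{k+1}=x_k-\eta_k\hat d_k$. The iterate considered is the random iterate $x_{N_K}$, where $N_K$ is drawn at random with $\mathbb P(N_K=k)=\eta_k\beta_k/\sum_{k'=0}^{K-1}\eta_{k'}\beta_{k'}$ for $k\in\{0,\dots,K-1\}$ (for constant parameters, the uniform law). *)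

(* Defs.v *)
From HB Require Import structures.
From mathcomp Require Import all_boot all_order all_algebra.
From mathcomp Require Import finmap.
From mathcomp Require Import sesquilinear.
From mathcomp Require Import all_classical all_reals all_analysis.
Import Order.TTheory GRing.Theory Num.Theory.
Import numFieldNormedType.Exports.
Set Implicit Arguments.
Unset Strict Implicit.
Unset Printing Implicit Defensive.
Local Open Scope classical_set_scope.
Local Open Scope ring_scope.

Section hilbert_valued_random_elements.
Context {R : realType} {H : completeNormedModType R}.

(* Bochner measurability: pointwise limit of measurable maps with finite
   range. In a separable H this is Borel measurability; in general it is the
   class that is stable under sums, norms and inner products. *)
Definition strongly_measurable d (T : measurableType d) (X : T -> H) : Prop :=
  exists s : nat -> T -> H,
    (forall n, finite_set (range (s n)) /\
       forall y, measurable (s n @^-1` [set y])) /\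
    (forall t, s n t @[n --> \oo] --> X t).

(* Joint measurability of a random field (xi, x) |-> V xi x, in the form
   needed to evaluate it at a random point. It avoids the Borel sets of H,
   which behave badly under products when H is not separable. *)
Definition jointly_measurable d (Xi : measurableType d) (V : Xi -> H -> H)
    : Prop :=
  forall d' (T : measurableType d') (X : T -> H), strongly_measurable X ->
    strongly_measurable (fun p : (Xi * T)%type => V p.1 (X p.2)).

(* m is the expectation of the H-valued random element X: the vector that
   represents the functional v |-> E <X, v>. For X strongly measurable with
   E `|X| < oo it is the Bochner integral of X. *)
Record is_mean (ip : {dot H for idfun}) d (T : measurableType d)
    (P : probability T R) (X : T -> H) (m : H) : Prop := {
  mean_measurable : strongly_measurable X ;
  mean_integrable : P.-integrable setT (fun t => `|X t|%:E) ;
  mean_weak : forall v, ('E_P[fun t => ip (X t) v] = (ip m v)%:E)%E }.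

Definition is_gradient (ip : {dot H for idfun}) (f : H -> R) (x gx : H)
    : Prop :=
  differentiable f x /\ forall v, 'd f x v = ip gx v.

(* The smooth objective f = E_xi f_xi, with gradient df = E_xi (grad f_xi),
   where F xi and dF xi stand for f_xi and its gradient. *)
Record smooth_stochastic_objective (ip : {dot H for idfun})
    d (Xi : measurableType d) (PXi : probability Xi R)
    (F : Xi -> H -> R) (dF : Xi -> H -> H) (f : H -> R) (df : H -> H)
    (L sigma2 : R) : Prop := {
  obj_integrable : forall x, PXi.-integrable setT (fun xi => (F xi x)%:E) ;
  obj_mean : forall x, ((f x)%:E = 'E_PXi[fun xi => F xi x])%E ;
  obj_realization_gradient : forall xi x, is_gradient ip (F xi) x (dF xi x) ;
  obj_gradient : forall x, is_gradient ip f x (df x) ;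
  obj_measurable : jointly_measurable dF ;
  obj_mean_gradient : forall x, is_mean ip PXi (fun xi => dF xi x) (df x) ;
  obj_lipschitz : L.-lipschitz df ;
  obj_variance : forall x,
    ('E_PXi[fun xi => (`|dF xi x - df x| ^+ 2)%R] <= sigma2%:E)%E }.

Definition argmin (g : H -> R) : set H := [set x | forall y, g x <= g y].

Section stationarity.
Variables df dg : H -> H.

Definition stationary (ef eg : R) (x : H) : Prop :=
  exists lam : R, [/\ 0 <= lam, `|df x + lam *: dg x| ^+ 2 <= ef
                    & `|dg x| ^+ 2 <= eg].

(* For a random point the multiplier is a random variable as well. *)
Definition stationary_in_mean (ef eg : R) d (Om : measurableType d)
    (P : probability Om R) (X : Om -> H) : Prop :=
  exists lam : {RV P >-> R}, [/\ forall w, 0 <= lam w,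
    ('E_P[fun w => (`|df (X w) + lam w *: dg (X w)| ^+ 2)%R] <= ef%:E)%E
    & ('E_P[fun w => (`|dg (X w)| ^+ 2)%R] <= eg%:E)%E].

Definition stationary_with_probability (p ef eg : R) d (Om : measurableType d)
    (P : probability Om R) (X : Om -> H) : Prop :=
  exists A : set Om, [/\ measurable A, (p%:E <= P A)%E
    & forall w, A w -> stationary ef eg (X w)].

End stationarity.
End hilbert_valued_random_elements.

Section algorithm.
Context {R : realType} {H : completeNormedModType R} (ip : {dot H for idfun}).

Definition minibatch (Xi : Type) (dF : Xi -> H -> H) (B : nat)
    (xi : nat -> Xi) (x : H) : H :=
  B%:R^-1 *: \sum_(i < B) dF (xi i) x.

Definition multiplier (beta rho : R) (u v : H) : R :=
  Num.max (beta * `|v| ^+ 2 - ip u v) 0 / (`|v| ^+ 2 + rho).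

Fixpoint sdbgd (Xi Zt : Type) (dF : Xi -> H -> H) (dG : Zt -> H -> H) (x0 : H)
    (eta beta rho : nat -> R) (Bf Bg : nat -> nat)
    (xi : nat -> nat -> Xi) (zeta : nat -> nat -> Zt) (k : nat) : H :=
  if k is j.+1 then
    let x := sdbgd dF dG x0 eta beta rho Bf Bg xi zeta j in
    let u := minibatch dF (Bf j) (xi j) x in
    let v := minibatch dG (Bg j) (zeta j) x in
    x - eta j *: (u + multiplier (beta j) (rho j) u v *: v)
  else x0.

End algorithm.

Section sampling.
Context {R : realType}.

Definition mutually_independent d (Om : measurableType d)
    (P : probability Om R) (I : choiceType) (D : set I)
    (S : I -> set_system Om) : Prop :=
  forall (J : {fset I}) (A : I -> set Om), [set` J] `<=` D ->
    (forall i, i \in J -> S i (A i)) ->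
    P (\bigcap_(i in [set` J]) A i) = (\prod_(i <- J) P (A i))%E.

Context dX dZ d (Xi : measurableType dX) (Zt : measurableType dZ)
  (Om : measurableType d) (PXi : probability Xi R) (PZt : probability Zt R)
  (P : probability Om R).

(* Labels: Some (inl (k, i)) for the sample xi_{k,i}, Some (inr (k, j)) for
   zeta_{k,j}, and None for the random index N. *)
Definition draw : choiceType := option (nat * nat + nat * nat)%type.

Definition drawn (K : nat) (Bf Bg : nat -> nat) : set draw :=
  [set l | match l with
           | Some (inl (k, i)) => (k < K)%N && (i < Bf k)%N
           | Some (inr (k, j)) => (k < K)%N && (j < Bg k)%N
           | None => true
           end].

Definition generated (xi : nat -> nat -> {RV P >-> Xi})
    (zeta : nat -> nat -> {RV P >-> Zt}) (N : {RV P >-> nat}) (l : draw)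
    : set_system Om :=
  match l with
  | Some (inl (k, i)) => preimage_set_system setT (xi k i) measurable
  | Some (inr (k, j)) => preimage_set_system setT (zeta k j) measurable
  | None => preimage_set_system setT N measurable
  end.

Record sdbgd_sampling (K : nat) (eta beta : nat -> R) (Bf Bg : nat -> nat)
    (xi : nat -> nat -> {RV P >-> Xi}) (zeta : nat -> nat -> {RV P >-> Zt})
    (N : {RV P >-> nat}) : Prop := {
  law_xi : forall k i, (k < K)%N -> (i < Bf k)%N ->
    forall A, measurable A -> distribution P (xi k i) A = PXi A ;
  law_zeta : forall k j, (k < K)%N -> (j < Bg k)%N ->
    forall A, measurable A -> distribution P (zeta k j) A = PZt A ;
  law_index : forall k, (k < K)%N -> P (N @^-1` [set k]) =
    (eta k * beta k / (\sum_(j < K) eta j * beta j))%:E ;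
  draws_independent :
    mutually_independent P (drawn K Bf Bg) (generated xi zeta N) }.

End sampling.

Section schedule.
Context {R : realType}.

(* A batch-size proportional to y with constant c is an integer at distance
   less than 1 from c * y, whatever the rounding. *)
Definition batch_propto (c y : R) (B : nat) : Prop :=
  (1 <= B)%N /\ `|B%:R - c * y| < 1.

(* Parameters eta K, beta K, rho K, Bf K, Bg K of the run of horizon K. *)
Record sdbgd_schedule (a b r cf cg : R) (eta beta rho : nat -> R)
    (Bf Bg : nat -> nat) : Prop := {
  eta_propto : forall K, (1 <= K)%N -> eta K = a * K%:R `^ (- 4^-1) ;
  beta_propto : forall K, (1 <= K)%N -> beta K = b * (eta K ^- 3 * K%:R^-1) ;
  rho_propto : forall K, (1 <= K)%N -> rho K = r * (eta K ^- 2 * K%:R ^- 2) ;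
  Bf_propto : forall K, (1 <= K)%N ->
    batch_propto cf (eta K ^+ 4 * K%:R ^+ 2) (Bf K) ;
  Bg_propto : forall K, (1 <= K)%N ->
    batch_propto cg (eta K ^+ 6 * K%:R ^+ 4) (Bg K) }.

(* S eps K: the target accuracy eps is reached with horizon K. It has to be
   reached for every horizon beyond K_eps = O(eps^-2); the run of horizon
   K_eps makes \sum_(k < K_eps) B_{f,k} upper-level and
   \sum_(k < K_eps) B_{g,k} lower-level oracle calls. *)
Definition sdbgd_complexity (Bf Bg : nat -> nat) (S : R -> nat -> Prop)
    : Prop :=
  exists Keps : R -> nat,
  [/\ forall eps, 0 < eps -> (1 <= Keps eps)%N /\
        forall K, (Keps eps <= K)%N -> S eps K,
      (fun eps => (Keps eps)%:R : R) =O_ (0^'+) (fun eps : R => eps ^- 2),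
      (fun eps => (\sum_(k < Keps eps) Bf (Keps eps))%:R : R)
        =O_ (0^'+) (fun eps : R => eps ^- 4)
    & (fun eps => (\sum_(k < Keps eps) Bg (Keps eps))%:R : R)
        =O_ (0^'+) (fun eps : R => eps ^- 7)].

End schedule.

(* Main.v *)
(* Let u, v be the mini-batch gradients at x_k, d = u + lam v the direction,
   e = |u - grad f(x_k)| and e' = |v - grad g(x_k)|.  Since
   <d, v> >= beta |v|^2 - rho lam, with equality when lam > 0, descent on g
   controls beta |v|^2 and descent on f controls |d|^2, up to e, e' and terms of
   the order of the step parameters.  The combination
   f / eta + c g / (eta beta), with c of the order of beta / eta, absorbs all the
   cross terms, so that summing over k bounds sum_k (|v|^2 + |d|^2) pathwise by
   constants and sums of e^2 and e'^2; no integrability of f(x_k) or g(x_k) is needed.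
   Mini-batching gives E e^2 <= sigma_f^2 / B_f and E e'^2 <= sigma_g^2 / B_g.
   With s = K^(-1/4) the parameters are eta ~ s, beta ~ s, rho ~ s^6,
   1 / B_f ~ s^4, 1 / B_g ~ s^10, and all terms of the average are O(s^2),
   i.e. O(K^(-1/2)).  The multiplier certifying stationarity is computed from
   grad f(x_k) and v: it is bounded by the deterministic beta + G_f / (2 sqrt rho),
   so E (lam^2 e'^2) needs no independence of the two mini-batches. *)

Require Import Defs.
From HB Require Import structures.
From mathcomp Require Import all_boot all_order all_algebra.
From mathcomp Require Import finmap.
From mathcomp Require Import sesquilinear.
From mathcomp Require Import all_classical all_reals all_analysis.
From mathcomp Require Import measurable_realfun.
From mathcomp Require Import ring lra.
Import Order.TTheory GRing.Theory Num.Theory.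
Import numFieldNormedType.Exports.
Set Implicit Arguments.
Unset Strict Implicit.
Unset Printing Implicit Defensive.
Local Open Scope classical_set_scope.
Local Open Scope ring_scope.

(** * Inner products and the descent lemma *)

(** Since [beta / eta] does not depend on K, [c] can be a constant; it is chosen to turn the
    smoothness condition on g into an equality. The other condition, [beta^2 <= c / 4], then holds
    only once [K^(-1/2)] is small, and this is where the threshold on K comes from. The schedule
    balances three terms at [K^(-1/2)]: the initial gap of g over [eta * beta * K], the bias
    [beta^2], and the regularization loss [sqrt rho / beta]. The probabilistic obstacle is that x_k
    depends on all earlier samples while H may be nonseparable. Conditional expectations of H-valued
    maps are avoided: a new sample paired with the scenario, the scenario space carrying only the
    sigma-algebra of the past, has a product law, so Tonelli and Fubini freeze the past. The random
    index is treated as one more fresh sample. Measurability goes through pointwise limits of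
    finite-range maps, and only real-valued functions are integrated. *)

Section hilbert_space.
Context {R : realType} {H : completeNormedModType R} (ip : {dot H for idfun}).
Hypothesis ip_norm : forall x : H, ip x x = `|x| ^+ 2.

Lemma ipC x y : ip x y = ip y x.
Proof. by rewrite hermC /= expr0 mul1r. Qed.

Lemma ipDl x y z : ip (x + y) z = ip x z + ip y z.
Proof. by rewrite linearDl. Qed.

Lemma ipZr a x y : ip x (a *: y) = a * ip x y.
Proof. by rewrite linearZr. Qed.

Lemma ipZl a x y : ip (a *: x) y = a * ip x y.
Proof. by rewrite linearZl_LR. Qed.

Lemma ipNr x y : ip x (- y) = - ip x y.
Proof. by rewrite linearNr. Qed.

Lemma ipNl x y : ip (- x) y = - ip x y.
Proof. by rewrite linearNl. Qed.

Lemma sqr_normD x y : `|x + y| ^+ 2 = `|x| ^+ 2 + 2 * ip x y + `|y| ^+ 2.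
Proof.
by rewrite -!ip_norm linearDl linearDr linearDr /= (ipC y x); ring.
Qed.

(** Writing [ip] through norms alone makes its sequential continuity a consequence of that of the
    norm. *)
Lemma ip_polarization x y : ip x y = 4^-1 * (`|x + y| ^+ 2 - `|x - y| ^+ 2).
Proof. by rewrite !sqr_normD normrN ipNr; field. Qed.

(** Cauchy-Schwarz: expand the squared norm of [|y| x - |x| y] and divide by [|x| |y|]. *)
Lemma ip_le_norm x y : ip x y <= `|x| * `|y|.
Proof.
have [->|x0] := eqVneq x 0; first by rewrite linear0l normr0 mul0r.
have [->|y0] := eqVneq y 0; first by rewrite linear0r normr0 mulr0.
have /= := sqr_ge0 `| `|y| *: x - `|x| *: y |.
rewrite sqr_normD normrN ipNr ipZl ipZr !normrZ !normr_id => h.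
have p : 0 < `|x| * `|y| by rewrite mulr_gt0 // normr_gt0.
by rewrite -(ler_pM2l p); nra.
Qed.

Lemma normr_ip_le x y : `|ip x y| <= `|x| * `|y|.
Proof.
rewrite ler_norml ip_le_norm andbT lerNl -ipNl -(normrN x).
exact: ip_le_norm.
Qed.

Lemma lipschitzP (V W : normedModType R) (L : R) (h : V -> W) :
  L.-lipschitz h -> forall x y, `|h x - h y| <= L * `|x - y|.
Proof. by move=> hL x y; exact: (hL (x, y)). Qed.

Section line.
Variables (f : H -> R) (df : H -> H).
Hypothesis dfE : forall x, is_gradient ip f x (df x).

Lemma is_derive_line x h (t : R) :
  is_derive t 1 (fun s : R => f (x + s *: h)) (ip (df (x + t *: h)) h).
Proof.
have [fdiff fd] := dfE (x + t *: h).
have lin : is_diff t (fun s : R => x + s *: h) (fun s : R => s *: h).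
  have -> : (fun s : R => x + s *: h) = cst x + ( *:%R^~ h).
    by apply/funext.
  by apply: is_diff_eq; rewrite add0r.
have cmp : is_diff t (fun s : R => f (x + s *: h))
    (fun s => 'd f (x + t *: h) (s *: h)).
  exact: (@is_diff_comp _ _ _ _ (fun s : R => x + s *: h)
    (fun s => s *: h) f ('d f (x + t *: h)) t).
apply: DeriveDef; first by apply: diff_derivable.
by rewrite deriveE // diff_val fd scale1r.
Qed.

(** Monotonicity in one real variable replaces integrating the gradient along the segment: [phi] is
    f on the segment minus the linear and quadratic terms of the bound, and Cauchy-Schwarz with the
    Lipschitz property makes its derivative nonpositive on []0, 1[]. *)
Lemma smooth_descent L x h : L.-lipschitz df ->
  f (x + h) <= f x + ip (df x) h + L / 2 * `|h| ^+ 2.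
Proof.
move=> dfL; pose q := `|h| ^+ 2.
pose phi (t : R) := f (x + t *: h) - t * ip (df x) h - t ^+ 2 * (L / 2 * q).
pose dphi t := ip (df (x + t *: h)) h - ip (df x) h - t * (L * q).
have phiE (t : R) : is_derive t 1 phi (dphi t).
  have ? := is_derive_line x h t.
  apply: is_derive_eq.
  by rewrite /dphi /= /GRing.scale /=; field.
have phile : phi 1 <= phi 0.
  apply: (@ler0_derive1_nincr _ phi 0 1 _ _ _ 0 1) => // [u u01|].
  - rewrite derive1E; move: u01; rewrite in_itv /= => /andP[u0 t1].
    rewrite (@derive_val _ _ _ _ _ _ _ (phiE u)) /dphi subr_le0 -ipNl -linearDl.
    apply: le_trans (ip_le_norm _ _) _.
    have := lipschitzP dfL (x + u *: h) x.
    rewrite addrAC subrr add0r normrZ (gtr0_norm u0) => le1.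
    by rewrite /q; have := normr_ge0 h; nra.
  - apply: continuous_subspaceT => t; apply: differentiable_continuous.
    by apply/derivable1_diffP; have [] := phiE t.
move: phile; rewrite /phi scale1r scale0r addr0 /q; lra.
Qed.
End line.
End hilbert_space.

(** * One step of the algorithm *)

Section multiplier_bounds.
Context {R : realType} {H : completeNormedModType R} (ip : {dot H for idfun}).
Hypothesis ip_norm : forall x : H, ip x x = `|x| ^+ 2.
Variables (beta t : R).
Hypotheses (beta_gt0 : 0 < beta) (t_gt0 : 0 < t).
Local Notation lam := (multiplier ip beta (t ^+ 2)).

Let den_gt0 (v : H) : 0 < `|v| ^+ 2 + t ^+ 2.
Proof. by rewrite ltr_wpDl ?sqr_ge0 // exprn_gt0. Qed.

Lemma multiplier_ge0 u v : 0 <= lam u v.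
Proof. by apply: divr_ge0; [rewrite le_max lexx orbT|exact: ltW]. Qed.

Lemma multiplierM u v :
  lam u v * (`|v| ^+ 2 + t ^+ 2) = Num.max (beta * `|v| ^+ 2 - ip u v) 0.
Proof. by rewrite /multiplier divfK // gt_eqF. Qed.

(** AM-GM, [2 t |v| <= |v|^2 + t^2], against the denominator. The regularization is written [t ^+ 2]
    because its square root appears here. *)
Lemma multiplier_le u v : lam u v <= beta + `|u| / (2 * t).
Proof.
rewrite -(ler_pM2r (den_gt0 v)) multiplierM.
have := ip_le_norm ip_norm (- u) v; rewrite normrN (ipNl ip) => iple.
have ut : `|u| / (2 * t) * (`|v| ^+ 2 + t ^+ 2) - `|u| * `|v| =
    `|u| * (`|v| - t) ^+ 2 / (2 * t).
  by field; rewrite gt_eqF.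
have := mulr_ge0 (mulr_ge0 (normr_ge0 u) (sqr_ge0 (`|v| - t)))
  (ltW (_ : 0 < (2 * t)^-1)); rewrite -ut invr_gt0 mulr_gt0 // => /(_ isT) ut0.
have bt := mulr_ge0 (ltW beta_gt0) (sqr_ge0 t).
rewrite ge_max; apply/andP; split; first by lra.
have := mulr_ge0 (normr_ge0 u) (normr_ge0 v).
have := mulr_ge0 (ltW beta_gt0) (sqr_ge0 `|v|).
by lra.
Qed.

(** Obtained by dropping the maximum in [multiplierM]. By [multiplier_le] the loss [t^2 lam] is at
    most [t^2 beta + t |u| / 2], hence small with t. *)
Lemma direction_ip_ge u v :
  beta * `|v| ^+ 2 - t ^+ 2 * lam u v <= ip (u + lam u v *: v) v.
Proof.
rewrite (ipDl ip) (ipZl ip) ip_norm.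
have := multiplierM u v.
have : beta * `|v| ^+ 2 - ip u v <= Num.max (beta * `|v| ^+ 2 - ip u v) 0.
  by rewrite le_max lexx.
by lra.
Qed.

(** Complementarity: either [lam] vanishes, or the maximum is its first argument and the inner
    product of direction and [v] equals [beta |v|^2 - t^2 lam], at most [beta |v|^2]. Cauchy-Schwarz
    then bounds [lam |v|^2]. *)
Lemma multiplier_direction_ip_le u v :
  lam u v * ip (u + lam u v *: v) v <=
  beta * (beta * `|v| ^+ 2 + `|u| * `|v|).
Proof.
rewrite (ipDl ip) (ipZl ip) ip_norm.
have l0 := multiplier_ge0 u v; have lE := multiplierM u v.
have iple := ip_le_norm ip_norm (- u) v; rewrite normrN (ipNl ip) in iple.
have vv := sqr_ge0 `|v|; have tt := sqr_ge0 t.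
have uv := mulr_ge0 (normr_ge0 u) (normr_ge0 v).
move: lE; case: (lerP (beta * `|v| ^+ 2 - ip u v) 0) => [_|p] lE.
  have -> : lam u v = 0.
    by move/eqP: lE; rewrite mulf_eq0 (gt_eqF (den_gt0 v)) orbF => /eqP.
  by rewrite !mul0r mulr_ge0 ?addr_ge0 ?mulr_ge0 // ltW.
have lt := mulr_ge0 l0 tt.
have lv : lam u v * `|v| ^+ 2 <= beta * `|v| ^+ 2 + `|u| * `|v| by lra.
have -> : ip u v + lam u v * `|v| ^+ 2 = beta * `|v| ^+ 2 - t ^+ 2 * lam u v.
  by lra.
have := mulr_ge0 l0 lt; have := ler_wpM2l (ltW beta_gt0) lv.
by lra.
Qed.

(** The positive part is 1-Lipschitz and the denominator is at least [|v|^2]. The factor [|v|] makes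
    the bound uniform in [v] and [t]; it allows the noisy [u] to be exchanged for the exact gradient
    inside the multiplier. *)
Lemma multiplier_lipschitz u u' v :
  `|lam u v - lam u' v| * `|v| <= `|u - u'|.
Proof.
have [->|v0] := eqVneq v 0; first by rewrite normr0 mulr0.
have vp : 0 < `|v| by rewrite normr_gt0.
have key w w' : lam w v - lam w' v <= `|w - w'| * `|v| / `|v| ^+ 2.
  have [le0|lt0] := lerP (lam w v - lam w' v) 0.
    by apply: le_trans le0 _; rewrite divr_ge0 // mulr_ge0.
  rewrite ler_pdivlMr ?exprn_gt0 //.
  apply: (@le_trans _ _ ((lam w v - lam w' v) * (`|v| ^+ 2 + t ^+ 2))).
    by rewrite ler_pM2l // lerDl sqr_ge0.
  rewrite mulrBl !multiplierM lerBlDr ge_max; apply/andP; split; last first.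
    by rewrite addr_ge0 ?mulr_ge0 // le_max lexx orbT.
  apply: (@le_trans _ _ (`|w - w'| * `|v| + (beta * `|v| ^+ 2 - ip w' v))).
    have := ip_le_norm ip_norm (w' - w) v.
    by rewrite distrC (ipDl ip) (ipNl ip); lra.
  by rewrite lerD2l le_max lexx.
have {}key : `|lam u v - lam u' v| <= `|u - u'| / `|v|.
  have vE (z : R) : z * `|v| / `|v| ^+ 2 = z / `|v|.
    by field; rewrite gt_eqF.
  rewrite ler_norml; have := key u u'; have := key u' u.
  by rewrite !vE (distrC u' u) => k1 k2; apply/andP; split; lra.
by rewrite -ler_pdivlMr.
Qed.

End multiplier_bounds.

Section one_step.
Context {R : realType} {H : completeNormedModType R} (ip : {dot H for idfun}).
Hypothesis ip_norm : forall x : H, ip x x = `|x| ^+ 2.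
Variables (f g : H -> R) (df dg : H -> H) (Lf Lg Gf beta t eta c : R).
Hypotheses (fE : forall x, is_gradient ip f x (df x))
  (gE : forall x, is_gradient ip g x (dg x))
  (fL : Lf.-lipschitz df) (gL : Lg.-lipschitz dg).
Hypothesis df_bounded : forall x, `|df x| <= Gf.
Hypotheses (beta_gt0 : 0 < beta) (t_gt0 : 0 < t) (eta_gt0 : 0 < eta)
  (c_gt0 : 0 < c).
Hypotheses (eta_le : Lf * eta <= 2^-1) (c_le : c * Lg * eta <= beta / 4)
  (beta_le : beta ^+ 2 <= c / 4).
Local Notation lam := (multiplier ip beta (t ^+ 2)).
Variables (x u v : H).
Let d := u + lam u v *: v.
Let e := `|u - df x|.
Let ee := `|v - dg x|.

(** Descent on f, with the inner product of [u] and [d] rewritten as [|d|^2 - lam <d, v>] and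
    complementarity for the second term. The summand [|d|^2 / 4] is the smoothness term after
    [Lf * eta <= 1/2]. *)
Lemma upper_step :
  `|d| ^+ 2 <= (f x - f (x - eta *: d)) / eta + beta ^+ 2 * `|v| ^+ 2
    + beta * ((Gf + e) * `|v|) + e * `|d| + `|d| ^+ 2 / 4.
Proof.
have := smooth_descent ip_norm fE x (- (eta *: d)) fL.
rewrite normrN (ipNr ip) (ipZr ip) normrZ (gtr0_norm eta_gt0) => desc.
have dfE : ip (df x) d = ip u d - ip (u - df x) d.
  by rewrite (ipDl ip) (ipNl ip) opprB addrC subrK.
have uE : ip u d = `|d| ^+ 2 - lam u v * ip d v.
  by rewrite -ip_norm {2}/d (ipDl ip) (ipZl ip) (ipC ip v d) addrK.
have l1 := multiplier_direction_ip_le ip_norm beta_gt0 t_gt0 u v.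
have l2 : ip (u - df x) d <= e * `|d| by exact: ip_le_norm.
have ue : `|u| <= Gf + e.
  by rewrite -[u in `|u|](subrK (df x)) addrC (le_trans (ler_normD _ _)) // lerD2r.
have uv : `|u| * `|v| <= (Gf + e) * `|v| by rewrite ler_wpM2r.
have quad : Lf * eta * `|d| ^+ 2 <= 2^-1 * `|d| ^+ 2.
  by rewrite ler_wpM2r ?sqr_ge0.
rewrite -subr_ge0 -(pmulr_rge0 _ eta_gt0).
have -> : forall A B C D E X Y : R, eta * ((A - B) / eta + C + D + E + X - Y) =
    A - B + eta * (C + D + E + X - Y).
  by move=> *; field; rewrite gt_eqF.
have l3 := ler_wpM2l (ltW eta_gt0) l1.
have l4 := ler_wpM2l (ltW eta_gt0) l2.
have l5 := ler_wpM2l (ltW (mulr_gt0 eta_gt0 beta_gt0)) uv.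
have l6 := ler_wpM2l (ltW eta_gt0) quad.
rewrite dfE uE in desc.
rewrite -/d in l3 l4 desc *.
by nra.
Qed.

(** Descent on g divided by [eta * beta], which turns the gain [beta |v|^2] of [direction_ip_ge]
    into [|v|^2]. The two terms in [t] are its regularization loss, bounded by [multiplier_le]. *)
Lemma lower_step :
  `|v| ^+ 2 <= (g x - g (x - eta *: d)) / (eta * beta) + t ^+ 2
    + (Gf + e) * t / (2 * beta) + ee * `|d| / beta
    + Lg * eta * `|d| ^+ 2 / (2 * beta).
Proof.
have := smooth_descent ip_norm gE x (- (eta *: d)) gL.
rewrite normrN (ipNr ip) (ipZr ip) normrZ (gtr0_norm eta_gt0) => desc.
have dgE : ip (dg x) d = ip d v - ip (v - dg x) d.
  by rewrite (ipDl ip v) (ipNl ip) opprB addrC (ipC ip v d) subrK.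
have l1 := direction_ip_ge ip_norm beta t_gt0 u v.
have l2 : ip (v - dg x) d <= ee * `|d| by exact: ip_le_norm.
have ue : `|u| <= Gf + e.
  by rewrite -[u in `|u|](subrK (df x)) addrC (le_trans (ler_normD _ _)) // lerD2r.
have l7 : t ^+ 2 * lam u v <= t ^+ 2 * beta + (Gf + e) * t / 2.
  have := ler_wpM2l (sqr_ge0 t) (multiplier_le ip_norm beta_gt0 t_gt0 u v).
  have -> : t ^+ 2 * (beta + `|u| / (2 * t)) = t ^+ 2 * beta + `|u| * t / 2.
    by field; rewrite gt_eqF.
  by have := ler_wpM2r (ltW t_gt0) ue; lra.
rewrite -subr_ge0 -(pmulr_rge0 _ (mulr_gt0 eta_gt0 beta_gt0)).
have -> : forall A B C D E X Y : R,
    eta * beta * ((A - B) / (eta * beta) + C + D / (2 * beta) + E / beta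
      + X / (2 * beta) - Y) =
    A - B + eta * (beta * C + D / 2 + E + X / 2 - beta * Y).
  by move=> *; field; rewrite !gt_eqF.
have l3 := ler_wpM2l (ltW eta_gt0) l1.
have l4 := ler_wpM2l (ltW eta_gt0) l2.
have l6 := ler_wpM2l (ltW eta_gt0) l7.
rewrite dgE in desc.
rewrite -/d in l3 l4 desc *.
by lra.
Qed.

(* Upper step plus c times the lower step; the cross terms are absorbed by
   Young's inequality. *)
Lemma combined_step :
  c / 2 * `|v| ^+ 2 + 3 / 8 * `|d| ^+ 2 <=
    (f x - f (x - eta *: d)) / eta + c * ((g x - g (x - eta *: d)) / (eta * beta))
    + (2 * beta ^+ 2 / c * (Gf ^+ 2 + e ^+ 2) + 2 * e ^+ 2
       + 2 * c ^+ 2 / beta ^+ 2 * ee ^+ 2 + c * t ^+ 2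
       + c * (t / (2 * beta)) * (Gf + 1 + e ^+ 2)).
Proof.
have := upper_step; have := lower_step.
move: (_ / (eta * beta)) (_ / eta) => A B lo up.
have V0 := sqr_ge0 `|v|; have D0 := sqr_ge0 `|d|.
have loc := ler_wpM2l (ltW c_gt0) lo.
(* Budget: of [|d|^2], a quarter is already spent in [upper_step], and [quad], [y3], [y4] take an
   eighth each, leaving [3 / 8]. Of [c |v|^2], [y1] and [y2] take a quarter each, leaving
   [c / 2]. *)
have quad : c * (Lg * eta * `|d| ^+ 2 / (2 * beta)) <= `|d| ^+ 2 / 8.
  have -> : c * (Lg * eta * `|d| ^+ 2 / (2 * beta)) =
      (c * Lg * eta) * (`|d| ^+ 2 / (2 * beta)) by ring.
  have -> : `|d| ^+ 2 / 8 = beta / 4 * (`|d| ^+ 2 / (2 * beta)).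
    by field; rewrite gt_eqF.
  by rewrite ler_wpM2r // divr_ge0 // mulr_ge0 // ltW.
have y1 : beta ^+ 2 * `|v| ^+ 2 <= c / 4 * `|v| ^+ 2 by rewrite ler_wpM2r.
have y2 : beta * ((Gf + e) * `|v|) <=
    c / 4 * `|v| ^+ 2 + 2 * beta ^+ 2 / c * (Gf ^+ 2 + e ^+ 2).
  have : 0 <= (c / 2 * `|v| - beta * (Gf + e)) ^+ 2 / c.
    by rewrite divr_ge0 ?sqr_ge0 // ltW.
  have -> : (c / 2 * `|v| - beta * (Gf + e)) ^+ 2 / c = c / 4 * `|v| ^+ 2
      - beta * ((Gf + e) * `|v|) + beta ^+ 2 / c * (Gf + e) ^+ 2.
    by field; rewrite gt_eqF.
  have : 0 <= beta ^+ 2 / c * (Gf - e) ^+ 2.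
    by rewrite mulr_ge0 ?sqr_ge0 // divr_ge0 ?sqr_ge0 // ltW.
  by lra.
have y3 : e * `|d| <= `|d| ^+ 2 / 8 + 2 * e ^+ 2.
  by have := sqr_ge0 (`|d| / 4 - e); lra.
have y4 : c * (ee * `|d| / beta) <=
    `|d| ^+ 2 / 8 + 2 * c ^+ 2 / beta ^+ 2 * ee ^+ 2.
  have := sqr_ge0 (`|d| / 4 - c * ee / beta).
  have -> : (`|d| / 4 - c * ee / beta) ^+ 2 = `|d| ^+ 2 / 16
     - c * (ee * `|d| / beta) / 2 + c ^+ 2 / beta ^+ 2 * ee ^+ 2.
    by field; rewrite gt_eqF.
  by lra.
(* The linear [e] is replaced by [1 + e^2], because the variance bounds control squares. *)
have y5 : c * ((Gf + e) * t / (2 * beta)) <=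
    c * (t / (2 * beta)) * (Gf + 1 + e ^+ 2).
  have -> : c * ((Gf + e) * t / (2 * beta)) = c * (t / (2 * beta)) * (Gf + e).
    by ring.
  apply: ler_wpM2l; first by apply: ltW; rewrite mulr_gt0 // divr_gt0 // mulr_gt0.
  by have := sqr_ge0 (e - 2^-1); lra.
by lra.
Qed.

(** Replacing [u] by [df x] costs [e] twice: once directly and once through [multiplier_lipschitz].
    Keeping [v] in the multiplier is what makes that lemma apply; replacing [v] by [dg x] outside
    costs [lam] times [ee]. Squaring a sum of three terms gives the factors 3, [3 * 2^2 = 12] and
    3. *)
Lemma stationarity_step :
  `|df x + lam (df x) v *: dg x| ^+ 2 <=
    3 * `|d| ^+ 2 + 12 * e ^+ 2 + 3 * (beta + Gf / (2 * t)) ^+ 2 * ee ^+ 2.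
Proof.
set l := lam (df x) v.
have l0 : 0 <= l by exact: multiplier_ge0.
have ll : l <= beta + Gf / (2 * t).
  apply: le_trans (multiplier_le ip_norm beta_gt0 t_gt0 _ _) _.
  by rewrite lerD2l ler_pM2r // invr_gt0 mulr_gt0.
have bound : `|df x + l *: dg x| <= `|d| + 2 * e + (beta + Gf / (2 * t)) * ee.
  have -> : df x + l *: dg x =
      d + ((df x - u) + (l - lam u v) *: v + l *: (dg x - v)).
    rewrite /d scalerBl scalerBr.
    rewrite [df x - u + _]addrACA -opprD addrA.
    rewrite [_ + (_ - (u + _))]addrC subrK addrACA subrr addr0 //.
  apply: le_trans (ler_normD _ _) _; rewrite -[leRHS]addrA lerD2l.
  apply: le_trans (ler_normD _ _) _; apply: lerD.
    apply: le_trans (ler_normD _ _) _; rewrite mulr_natl mulr2n.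
    apply: lerD; first by rewrite distrC.
    by rewrite normrZ /l /e (distrC u); exact: multiplier_lipschitz.
  by rewrite normrZ distrC (ger0_norm l0) ler_wpM2r // normr_ge0.
have e0 : 0 <= e by exact: normr_ge0.
have ee0 : 0 <= ee by exact: normr_ge0.
have m0 : 0 <= (beta + Gf / (2 * t)) * ee by rewrite mulr_ge0 // (le_trans l0).
have d0 := normr_ge0 d; have n0 := normr_ge0 (df x + l *: dg x).
have -> : 3 * (beta + Gf / (2 * t)) ^+ 2 * ee ^+ 2 =
  3 * ((beta + Gf / (2 * t)) * ee) ^+ 2 by ring.
move: bound; set m := _ * ee in m0 *; set n := `|_ + _| in n0 * => bound.
have : n ^+ 2 <= (`|d| + 2 * e + m) ^+ 2.
  by rewrite ler_sqr // nnegrE // !addr_ge0 // mulr_ge0.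
have := sqr_ge0 (`|d| - 2 * e); have := sqr_ge0 (`|d| - m).
have := sqr_ge0 (2 * e - m).
by lra.
Qed.

Lemma lower_stationarity_step :
  `|dg x| ^+ 2 <= 2 * `|v| ^+ 2 + 2 * `|v - dg x| ^+ 2.
Proof.
have le1 : `|dg x| <= `|v| + `|v - dg x|.
  by rewrite -[dg x in leLHS](subKr v) (le_trans (ler_normB _ _)).
have := sqr_ge0 (`|v| - `|v - dg x|).
have : `|dg x| ^+ 2 <= (`|v| + `|v - dg x|) ^+ 2.
  by rewrite ler_sqr // nnegrE // addr_ge0.
by lra.
Qed.

End one_step.

(** * Strong measurability *)

Section strong_measurability.
Context {R : realType} {H : completeNormedModType R}.

(** The preimage is a finite union of fibres, so neither a sigma-algebra on [U] nor any property of
    [B] is involved. *)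
Lemma finite_range_measurable_preimage d (T : measurableType d) (U : Type)
    (s : T -> U) (B : set U) : finite_set (range s) ->
  (forall y, measurable (s @^-1` [set y])) -> measurable (s @^-1` B).
Proof.
move=> fs ms.
have -> : s @^-1` B = \bigcup_(y in range s `&` B) s @^-1` [set y].
  apply/seteqP; split => [t Bt|t [y [_ By] /= ->]] //.
  by exists (s t) => //; split => //; exists t.
apply: fin_bigcup_measurable => [|y _]; last exact: ms.
by apply: sub_finite_set fs; exact: subIsetl.
Qed.

Lemma strongly_measurable_comp d d' (T : measurableType d)
    (T' : measurableType d') (X : T' -> H) (phi : T -> T') :
  measurable_fun setT phi -> strongly_measurable X ->
  strongly_measurable (X \o phi).
Proof.
move=> mphi [s [ms sX]]; exists (fun n => s n \o phi); split => [n|t]; last exact: sX.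
have [fs m1] := ms n; split.
  by apply: sub_finite_set fs => _ [t _ <-]; exists (phi t).
by move=> y; rewrite comp_preimage -[_ @^-1` _]setTI; exact: mphi.
Qed.

Lemma strongly_measurable_cst d (T : measurableType d) (a : H) :
  strongly_measurable (cst a : T -> H).
Proof.
exists (fun=> cst a); split => [n|t]; last exact: cvg_cst.
split; last by move=> y; rewrite preimage_cst; case: ifP.
by apply: sub_finite_set (finite_set1 a) => _ [t _ <-].
Qed.

(** Sequences suffice since strong measurability is itself defined by pointwise limits of sequences;
    the two arguments converge jointly, as the multiplier requires. *)
Definition seq_continuous2 (V W : topologicalType) (h : V -> V -> W) :=
  forall (u v : nat -> V) a b, u n @[n --> \oo] --> a ->
    v n @[n --> \oo] --> b -> h (u n) (v n) @[n --> \oo] --> h a b.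

(** Apply [h] to the finite-range approximations: the pair [p] has finite range and measurable
    fibres, hence so has its image. Sums, inner products and the whole update direction are
    instances. *)
Lemma strongly_measurable2 d (T : measurableType d)
    (W : completeNormedModType R) (h : H -> H -> W) (X Y : T -> H) :
  seq_continuous2 h -> strongly_measurable X -> strongly_measurable Y ->
  strongly_measurable (fun t => h (X t) (Y t)).
Proof.
move=> hc [s [ms sX]] [s' [ms' sY]].
exists (fun n t => h (s n t) (s' n t)); split => [n|t]; last first.
  by apply: (hc (s ^~ t) (s' ^~ t)).
have [f1 m1] := ms n; have [f2 m2] := ms' n.
pose p t := (s n t, s' n t).
have fp : finite_set (range p).
  by apply: sub_finite_set (finite_setX f1 f2) => _ [t _ <-]; split; exists t.
split.
  apply: sub_finite_set (finite_image (fun z => h z.1 z.2) fp) => _ [t _ <-].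
  by exists (p t) => //; exists t.
move=> y; apply: (finite_range_measurable_preimage
  (s := p) [set z | h z.1 z.2 = y]) => // -[a b].
have -> : p @^-1` [set (a, b)] = s n @^-1` [set a] `&` s' n @^-1` [set b].
  by apply/seteqP; split => t /=; rewrite /p; [case=> -> ->|case=> -> ->].
exact: measurableI.
Qed.

Lemma strongly_measurable_continuous d (T : measurableType d)
    (W : completeNormedModType R) (h : H -> W) (X : T -> H) :
  continuous h -> strongly_measurable X ->
  strongly_measurable (fun t => h (X t)).
Proof.
move=> hc mX; apply: (strongly_measurable2 (h := fun a _ => h a) _ mX mX).
by move=> u v a b ua _; apply: continuous_cvg => //; exact: hc.
Qed.

End strong_measurability.

Section real_valued.
Context {R : realType}.

Lemma strongly_measurable_real d (T : measurableType d) (X : T -> R) :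
  strongly_measurable X -> measurable_fun setT X.
Proof.
move=> [s [ms sX]]; apply: (@measurable_fun_cvg _ _ _ setT s) => [n|t _]; last first.
  exact: sX.
have [f1 m1] := ms n => _ B mB; rewrite setTI.
exact: finite_range_measurable_preimage.
Qed.
End real_valued.

Section hilbert_strong_measurability.
Context {R : realType} {H : completeNormedModType R} (ip : {dot H for idfun}).
Hypothesis ip_norm : forall x : H, ip x x = `|x| ^+ 2.
Context d (T : measurableType d).
Implicit Types X Y : T -> H.

Lemma strongly_measurableD X Y : strongly_measurable X ->
  strongly_measurable Y -> strongly_measurable (fun t => X t + Y t).
Proof.
by apply: (strongly_measurable2 (h := fun a b => a + b)) => u v a b; exact: cvgD.
Qed.

Lemma strongly_measurableB X Y : strongly_measurable X ->
  strongly_measurable Y -> strongly_measurable (fun t => X t - Y t).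
Proof.
by apply: (strongly_measurable2 (h := fun a b => a - b)) => u v a b; exact: cvgB.
Qed.

Lemma strongly_measurableZ (c : R) X : strongly_measurable X ->
  strongly_measurable (fun t => c *: X t).
Proof.
move=> mX; apply: (strongly_measurable2 (h := fun a b => c *: a) _ mX mX).
by move=> u v a b ua _; apply: cvgZr.
Qed.

Lemma strongly_measurable_sum n (X : nat -> T -> H) :
  (forall i, (i < n)%N -> strongly_measurable (X i)) ->
  strongly_measurable (fun t => \sum_(i < n) X i t).
Proof.
elim: n => [|n IH] mX.
  have -> : (fun t => \sum_(i < 0) X i t) = cst 0.
    by apply/funext => t; rewrite big_ord0.
  exact: strongly_measurable_cst.
have -> : (fun t => \sum_(i < n.+1) X i t) =
    (fun t => \sum_(i < n) X i t + X n t).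
  by apply/funext => t; rewrite big_ord_recr.
by apply: strongly_measurableD; [apply: IH => i /ltnW|]; exact: mX.
Qed.

Lemma cvg_sqr_norm (u : nat -> H) a : u n @[n --> \oo] --> a ->
  `|u n| ^+ 2 @[n --> \oo] --> `|a| ^+ 2.
Proof.
move=> ua; rewrite expr2; under eq_fun do rewrite expr2.
by apply: cvgM; exact: cvg_norm.
Qed.

Lemma seq_continuous2_ip : seq_continuous2 (fun x y => ip x y : R).
Proof.
move=> u v a b ua vb; rewrite (ip_polarization ip_norm).
under eq_fun do rewrite (ip_polarization ip_norm).
apply: cvgM; first exact: cvg_cst.
by apply: cvgB; apply: cvg_sqr_norm; [exact: cvgD|exact: cvgB].
Qed.

(** Positivity of [rho] keeps the denominator away from 0, and the maximum becomes an absolute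
    value, whose continuity is that of a norm. *)
Lemma seq_continuous2_multiplier beta rho : 0 < rho ->
  seq_continuous2 (multiplier ip beta rho).
Proof.
move=> rho0 u v a b ua vb; rewrite /multiplier.
have vv : `|v n| ^+ 2 @[n --> \oo] --> `|b| ^+ 2.
  exact: cvg_sqr_norm.
apply: cvgM; last first.
  apply: cvgV; first by rewrite gt_eqF // ltr_wpDl // sqr_ge0.
  by apply: cvgD => //; exact: cvg_cst.
rewrite maxr_absE; under eq_fun do rewrite maxr_absE.
apply: cvgM; last exact: cvg_cst.
suff bc : beta * `|v n| ^+ 2 - ip (u n) (v n) @[n --> \oo]
    --> beta * `|b| ^+ 2 - ip a b.
  apply: cvgD; first by apply: cvgD => //; exact: cvg_cst.
  by apply: cvg_norm; apply: cvgB => //; exact: cvg_cst.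
apply: cvgB; first by apply: cvgM => //; exact: cvg_cst.
exact: seq_continuous2_ip.
Qed.

Lemma measurable_sqr_norm X : strongly_measurable X ->
  measurable_fun setT (fun t => `|X t| ^+ 2).
Proof.
move=> mX; apply: strongly_measurable_real.
apply: (strongly_measurable2 (h := fun a b => `|a| ^+ 2 : R) _ mX mX).
by move=> u v a b ua _; exact: cvg_sqr_norm.
Qed.

Lemma measurable_ip X Y : strongly_measurable X -> strongly_measurable Y ->
  measurable_fun setT (fun t => ip (X t) (Y t)).
Proof.
move=> mX mY; apply: strongly_measurable_real.
exact: (strongly_measurable2 seq_continuous2_ip).
Qed.

Lemma measurable_multiplier beta rho X Y : 0 < rho ->
  strongly_measurable X -> strongly_measurable Y ->
  measurable_fun setT (fun t => multiplier ip beta rho (X t) (Y t)).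
Proof.
move=> rho0 mX mY; apply: strongly_measurable_real.
exact: (strongly_measurable2 (seq_continuous2_multiplier rho0)).
Qed.

Lemma strongly_measurable_direction beta rho X Y : 0 < rho ->
  strongly_measurable X -> strongly_measurable Y ->
  strongly_measurable
    (fun t => X t + multiplier ip beta rho (X t) (Y t) *: Y t).
Proof.
move=> rho0.
apply: (strongly_measurable2 (h := fun a b => a + multiplier ip beta rho a b *: b)).
move=> u v a b ua vb; apply: cvgD => //; apply: cvgZ => //.
exact: seq_continuous2_multiplier.
Qed.

End hilbert_strong_measurability.

(** * Independence *)

(** Uniqueness of measures on a pi-system: [B |-> P (A & B)] and [B |-> P A * P B] are finite
    measures that agree on [G], and the constant sequence [setT] exhausts the space. *)
Lemma independent_sigma_l d (Om : measurableType d) (R : realType)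
    (P : probability Om R) (G : set_system Om) (A : set Om) :
  G `<=` measurable -> setI_closed G -> G setT -> measurable A ->
  (forall B, G B -> P (A `&` B) = (P A * P B)%E) ->
  forall B, <<s G >> B -> P (A `&` B) = (P A * P B)%E.
Proof.
move=> Gm GI GT mA PAB B GB.
have PA0 : 0 <= fine (P A) by rewrite fine_ge0 // measure_ge0.
have PAE : P A = (fine (P A))%:E by rewrite fineK // fin_num_measure.
(* [mscale] takes its factor in the nonnegative reals, so [P A] is repackaged there. *)
have [r rE] : exists r : {nonneg R}, r%:num = fine (P A) by exists (NngNum PA0).
rewrite setIC PAE -rE.
apply: (@g_sigma_algebra_measure_unique _ R Om G Gm (fun=> setT) (fun=> GT) _
  (mrestr P mA) (mscale r P) GI _ _ B GB).
- by apply/seteqP; split=> // x _; exists 0%N.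
- by move=> C GC; rewrite /= /mrestr /mscale /= setIC PAB // PAE rE.
- move=> k; rewrite /= /mrestr setTI.
  by apply: le_lt_trans (probability_le1 _ _) _ => //; rewrite ltry.
Qed.

Lemma independent_sigma d (Om : measurableType d) (R : realType)
    (P : probability Om R) (G1 G2 : set_system Om) :
  G1 `<=` measurable -> setI_closed G1 -> G1 setT ->
  G2 `<=` measurable -> setI_closed G2 -> G2 setT ->
  (forall A B, G1 A -> G2 B -> P (A `&` B) = (P A * P B)%E) ->
  forall A B, <<s G1 >> A -> <<s G2 >> B -> P (A `&` B) = (P A * P B)%E.
Proof.
move=> m1 I1 T1 m2 I2 T2 ind A B s1 s2.
have mB : measurable B.
  by apply: (smallest_sub _ m2) s2; exact: sigma_algebra_measurable.
rewrite setIC muleC.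
apply: (independent_sigma_l m1 I1 T1 mB _ s1) => C GC.
rewrite setIC muleC.
by apply: (independent_sigma_l m2 I2 T2 (m1 _ GC) _ s2) => *; exact: ind.
Qed.

Section grouping.
Context d (Om : measurableType d) {R : realType} (P : probability Om R)
  (I : choiceType) (S : I -> set_system Om).
Hypothesis S_measurable : forall i, S i `<=` measurable.
Hypothesis S_setI : forall i, setI_closed (S i).
Hypothesis S_setT : forall i, S i setT.

(* The pi-system of finite intersections of events of the S i, i in D. *)
Definition cylinders (D : set I) : set_system Om :=
  [set A | exists (J : {fset I}) (F : I -> set Om),
    [/\ [set` J] `<=` D, forall i, S i (F i)
      & A = \bigcap_(i in [set` J]) F i]].

Lemma cylinders_sub D E : D `<=` E -> cylinders D `<=` cylinders E.
Proof.
by move=> DE A [J [F [JD SF ->]]]; exists J, F; split => // i /JD /DE.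
Qed.

Lemma cylinders_setT D : cylinders D setT.
Proof.
exists fset0, (fun=> setT); split => //.
by apply/seteqP; split.
Qed.

Lemma cylinders1 D i A : D i -> S i A -> cylinders D A.
Proof.
move=> Di SA; exists [fset i]%fset, (fun j => if j == i then A else setT).
split=> [j /=|j|]; first by rewrite inE => /eqP ->.
  by case: eqP => [->|_] //.
apply/seteqP; split => x; last by move/(_ i); rewrite eqxx; apply; rewrite /= inE.
by move=> Ax j /=; rewrite inE => /eqP ->; rewrite eqxx.
Qed.

Lemma cylinders_measurable D : cylinders D `<=` measurable.
Proof.
move=> A [J [F [_ SF ->]]]; apply: fin_bigcap_measurable => // i _.
exact: S_measurable (SF i).
Qed.

Lemma cylinders_setI D : setI_closed (cylinders D).
Proof.
move=> A B [J [F [JD SF ->]]] [J' [F' [JD' SF' ->]]].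
(* Events missing from one of the two families are padded with [setT], which lies in every [S i]. *)
exists (J `|` J')%fset.
exists (fun i => (if i \in J then F i else setT) `&`
                 (if i \in J' then F' i else setT)).
split=> [i /=|i|].
- by rewrite inE => /orP[/JD|/JD'].
- by apply: S_setI; case: ifP.
apply/seteqP; split => x.
  by move=> [xF xF'] i _; split; case: ifPn => // iJ; [exact: xF|exact: xF'].
move=> xF; split => i /= iJ.
  by have := xF i; rewrite /= inE iJ => /(_ isT) [].
by have := xF i; rewrite /= inE iJ orbT => /(_ isT) [].
Qed.

(** Grouping: independence is checked on the two pi-systems of cylinders and then extended to the
    generated sigma-algebras. *)
Lemma cylinders_independent D D1 D2 : mutually_independent P D S ->
  D1 `<=` D -> D2 `<=` D -> D1 `&` D2 = set0 ->
  forall A B, <<s cylinders D1 >> A -> <<s cylinders D2 >> B ->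
  P (A `&` B) = (P A * P B)%E.
Proof.
move=> ind D1D D2D D12; apply: independent_sigma;
  try exact: cylinders_measurable; try exact: cylinders_setI;
  try exact: cylinders_setT.
move=> _ _ [J [F [JD SF ->]]] [J' [F' [JD' SF' ->]]].
have dJ i : i \in J -> i \in J' = false.
  move=> /JD D1i; apply/negP => /JD' D2i.
  by have : (D1 `&` D2) i by []; rewrite D12.
(* As [J] and [J'] are disjoint, a single family serves both; the product over their union then
   splits. *)
pose F'' i := if i \in J then F i else F' i.
have FJ : \bigcap_(i in [set` J]) F i = \bigcap_(i in [set` J]) F'' i.
  by apply: eq_bigcapr => i /= iJ; rewrite /F'' iJ.
have FJ' : \bigcap_(i in [set` J']) F' i = \bigcap_(i in [set` J']) F'' i.
  by apply: eq_bigcapr => i /= iJ; rewrite /F''; case: ifP => // /dJ; rewrite iJ.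
have SF'' i : S i (F'' i) by rewrite /F''; case: ifP.
have D1J : [set` J] `<=` D by apply: subset_trans D1D.
have D2J : [set` J'] `<=` D by apply: subset_trans D2D.
rewrite FJ FJ' (ind J F'') // (ind J' F'') //.
have -> : \bigcap_(i in [set` J]) F'' i `&` \bigcap_(i in [set` J']) F'' i =
    \bigcap_(i in [set` (J `|` J')%fset]) F'' i.
  rewrite -bigcap_setU; congr (\bigcap_(i in _) _).
  by apply/seteqP; split => i /=; rewrite inE => /orP.
rewrite ind //; last by move=> i /=; rewrite inE => /orP[/D1J|/D2J].
rewrite -big_cat /=; apply: perm_big; apply: uniq_perm.
- by rewrite fset_uniq.
- rewrite cat_uniq !fset_uniq /= andbT; apply/hasPn => i iJ'.
  by apply/negP => /dJ; rewrite iJ'.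
- by move=> i; rewrite mem_cat inE.
Qed.

End grouping.

(** * Fresh samples and mini-batches *)

Section square_integrable.
Context {R : realType} {H : completeNormedModType R} (ip : {dot H for idfun}).
Hypothesis ip_norm : forall x : H, ip x x = `|x| ^+ 2.
Context d (T : measurableType d) (P : probability T R).
Implicit Types X Y : T -> H.
Local Open Scope ereal_scope.

Lemma le_integral_integrable (h : T -> R) (m : R) :
  measurable_fun setT h -> (forall t, 0 <= h t)%R ->
  \int[P]_t (h t)%:E <= m%:E -> P.-integrable setT (fun t => (h t)%:E).
Proof.
move=> mh h0 hm; apply/integrableP; split; first exact/measurable_EFinP.
under eq_integral do rewrite gee0_abs ?lee_fin //.
by apply: le_lt_trans hm _; rewrite ltry.
Qed.

Lemma integrable_ip X Y : strongly_measurable X -> strongly_measurable Y ->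
  P.-integrable setT (fun t => (`|X t| ^+ 2)%:E) ->
  P.-integrable setT (fun t => (`|Y t| ^+ 2)%:E) ->
  P.-integrable setT (fun t => (ip (X t) (Y t))%:E).
Proof.
move=> mX mY iX iY; apply: le_integrable (integrableD _ iX iY) => //.
  by apply/measurable_EFinP; exact: measurable_ip.
move=> t _ /=; rewrite lee_fin (ger0_norm (addr_ge0 _ _)) ?sqr_ge0 //.
apply: le_trans (normr_ip_le ip_norm _ _) _.
have := sqr_ge0 (`|X t| - `|Y t|)%R.
by have := sqr_ge0 `|X t|%R; have := sqr_ge0 `|Y t|%R; lra.
Qed.

(** Pythagoras in mean square. The real bounds [m1] and [m2] also provide the integrability needed
    to split the integral. *)
Lemma second_moment_orthogonalD X Y (m1 m2 : R) :
  strongly_measurable X -> strongly_measurable Y ->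
  \int[P]_t (`|X t| ^+ 2)%:E <= m1%:E -> \int[P]_t (`|Y t| ^+ 2)%:E <= m2%:E ->
  \int[P]_t (ip (X t) (Y t))%:E = 0 ->
  \int[P]_t (`|X t + Y t| ^+ 2)%:E <= (m1 + m2)%:E.
Proof.
move=> mX mY lX lY XY.
have iX := le_integral_integrable (measurable_sqr_norm mX)
  (fun t => sqr_ge0 _) lX.
have iY := le_integral_integrable (measurable_sqr_norm mY)
  (fun t => sqr_ge0 _) lY.
have iXY := integrable_ip mX mY iX iY.
have i2 : P.-integrable setT (fun t => 2%:E * (ip (X t) (Y t))%:E).
  exact: integrableZl.
have i3 : P.-integrable setT
    (fun t => (`|X t| ^+ 2)%:E + 2%:E * (ip (X t) (Y t))%:E).
  exact: integrableD.
under eq_integral do rewrite (sqr_normD ip_norm) 2!EFinD EFinM.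
rewrite (integralD measurableT i3 iY) (integralD measurableT iX i2).
by rewrite (integralZl measurableT iXY) XY mule0 adde0 EFinD leeD.
Qed.

Lemma second_momentZ X (c m : R) : strongly_measurable X ->
  \int[P]_t (`|X t| ^+ 2)%:E <= m%:E ->
  \int[P]_t (`|c *: X t| ^+ 2)%:E <= (c ^+ 2 * m)%:E.
Proof.
move=> mX lX.
under eq_integral do rewrite normrZ exprMn real_normK ?num_real // EFinM.
rewrite ge0_integralZl ?lee_fin ?sqr_ge0 //.
- by rewrite [leRHS]EFinM lee_wpmul2l // lee_fin sqr_ge0.
- by apply/measurable_EFinP; exact: measurable_sqr_norm.
Qed.

End square_integrable.

Section fresh_sample.
Context {R : realType} d (Om : measurableType d) (P : probability Om R)
  (G : set_system Om) (G_measurable : G `<=` measurable).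
Local Notation OmG := (g_sigma_algebraType G).
Local Open Scope ereal_scope.

Lemma g_sigma_measurable : <<s G >> `<=` measurable.
Proof.
by apply: smallest_sub => //; exact: sigma_algebra_measurable.
Qed.

Lemma measurable_fun_coarsen : measurable_fun setT (id : Om -> OmG).
Proof.
by move=> _ A mA; rewrite setTI preimage_id; exact: g_sigma_measurable.
Qed.

(** The law of this identity map is the restriction of [P] to the sigma-algebra generated by [G];
    measurability on [OmG] means dependence on the past only. *)
Definition coarsen : {mfun Om >-> OmG} :=
  HB.pack (id : Om -> OmG) (isMeasurableFun.Build _ _ _ _ _ measurable_fun_coarsen).

Local Notation PG := (distribution P coarsen).

Context dX (Xi : measurableType dX) (PXi : probability Xi R)
  (xi : {mfun Om >-> Xi}).
Hypothesis xi_law : forall A, measurable A -> distribution P xi A = PXi A.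
Hypothesis xi_independent : forall A B,
  preimage_set_system setT xi measurable A -> <<s G >> B ->
  P (A `&` B) = P A * P B.

Let measurable_fun_joint :
  measurable_fun setT (fun w => (xi w, w) : Xi * OmG).
Proof. exact: measurable_fun_pair measurable_fun_coarsen. Qed.

Let joint : {mfun Om >-> (Xi * OmG)%type} :=
  HB.pack (fun w => (xi w, w) : (Xi * OmG)%type)
    (isMeasurableFun.Build _ _ _ _ _ measurable_fun_joint).

(** Independence of [xi] from the past, read on rectangles, says exactly that sample and past have a
    product law. *)
Let joint_lawE A : measurable A -> (PXi \x PG) A = distribution P joint A.
Proof.
apply: product_measure_unique => {}A B mA mB.
transitivity (PXi A * P B) => //; rewrite -xi_law //.
by apply: xi_independent => //; exists A => //; rewrite setTI.
Qed.

Lemma ge0_integral_fresh (h : Xi * OmG -> \bar R) :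
  measurable_fun setT h -> (forall p, 0 <= h p) ->
  \int[P]_w h (xi w, w) = \int[PG]_t \int[PXi]_x h (x, t).
Proof.
move=> mh h0; rewrite -[RHS]/(\int[PG]_t fubini_G PXi h t).
rewrite -fubini_tonelli2 //.
rewrite (eq_measure_integral (distribution P joint)) ?ge0_integral_distribution //.
by move=> A mA _; exact: joint_lawE.
Qed.

(** Fubini in place of conditioning, for signed integrands: integrability on [Om] is transported to
    the product through [joint]. *)
Lemma integral_fresh (h : Xi * OmG -> \bar R) :
  measurable_fun setT h -> P.-integrable setT (fun w => h (xi w, w)) ->
  \int[P]_w h (xi w, w) = \int[PG]_t \int[PXi]_x h (x, t).
Proof.
move=> mh ih; rewrite -[RHS]/(\int[PG]_t fubini_G PXi h t).
have ih' : (distribution P joint).-integrable setT h.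
  by apply: integrable_pushforward.
rewrite integral21_prod_meas1.
  rewrite (eq_measure_integral (distribution P joint)) ?integral_distribution //.
  by move=> A mA _; exact: joint_lawE.
move/integrableP: ih' => [_ ih']; apply/integrableP; split => //.
rewrite (eq_measure_integral (distribution P joint)) //.
by move=> A mA _; exact: joint_lawE.
Qed.

Context {H : completeNormedModType R} (ip : {dot H for idfun}).
Hypothesis ip_norm : forall x : H, ip x x = (`|x| ^+ 2)%R.
Variables (F : Xi -> H -> R) (dF : Xi -> H -> H) (f : H -> R) (df : H -> H)
  (L sigma2 : R).
Hypothesis obj : smooth_stochastic_objective ip PXi F dF f df L sigma2.

Lemma continuous_gradient : continuous df.
Proof.
move=> y; apply/(@cvgrPdist_le _ H) => e e0.
near=> z.
apply: le_trans (lipschitzP (obj_lipschitz obj) _ _) _.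
have dyz : (`|y - z| <= e / (`|L| + 1))%R.
  near: z; have /cvgrPdist_le := @cvg_id _ (nbhs y); apply.
  by rewrite divr_gt0 // ltr_wpDl.
apply: (@le_trans _ _ ((`|L| + 1) * `|y - z|)%R).
  by rewrite ler_wpM2r // (le_trans (ler_norm _)) // lerDl.
by rewrite mulrC -ler_pdivlMr // ltr_wpDl.
Unshelve. all: by end_near. Qed.

Variable x : OmG -> H.
Hypothesis mx : strongly_measurable x.

Let noise (p : Xi * OmG) : H := (dF p.1 (x p.2) - df (x p.2))%R.

Let strongly_measurable_noise : strongly_measurable noise.
Proof.
apply: strongly_measurableB; first exact: (obj_measurable obj).
apply: (strongly_measurable_comp (X := fun t => df (x t))) measurable_snd _.
exact: strongly_measurable_continuous continuous_gradient _.
Qed.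

(** Once the past is frozen the query point is a constant, where the variance assumption applies;
    the remaining integral has mass 1. *)
Lemma fresh_variance :
  \int[P]_w (`|dF (xi w) (x w) - df (x w)| ^+ 2)%:E <= sigma2%:E.
Proof.
rewrite (ge0_integral_fresh (h := fun p => (`|noise p| ^+ 2)%:E)); last 2 first.
- by apply/measurable_EFinP; exact: measurable_sqr_norm.
- by move=> p;
    rewrite lee_fin sqr_ge0.
have mm : measurable_fun setT (fun p => (`|noise p| ^+ 2)%:E).
  by apply/measurable_EFinP; exact: measurable_sqr_norm.
apply: (@le_trans _ _ (\int[PG]_t cst sigma2%:E t)); last first.
  rewrite integral_cst // [X in _ * X](_ : _ = 1) ?mule1 //.
  exact: (probability_setT PG).
apply: ge0_le_integral => //.
- by move=> t _; apply: integral_ge0 => y _; rewrite lee_fin sqr_ge0.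
- by apply: (measurable_fun_fubini_tonelli_G (m1 := PXi) _ mm) => p;
    rewrite lee_fin sqr_ge0.
- move=> t _; have := obj_variance obj (x t).
  by rewrite expectation.unlock.
Qed.

(** With the past frozen, [Y] is a fixed vector, and testing the weak mean of the gradient against
    it makes the inner integral vanish. The second moments of noise and [Y] justify Fubini. *)
Lemma fresh_orthogonal (Y : OmG -> H) (m : R) : strongly_measurable Y ->
  \int[P]_w (`|Y w| ^+ 2)%:E <= m%:E ->
  \int[P]_w (ip (dF (xi w) (x w) - df (x w)) (Y w))%:E = 0.
Proof.
move=> mY Ym.
have mY2 : strongly_measurable (fun p : Xi * OmG => Y p.2).
  exact: (strongly_measurable_comp (X := Y) measurable_snd mY).
have mI := measurable_ip ip_norm strongly_measurable_noise mY2.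
rewrite (integral_fresh (h := fun p => (ip (noise p) (Y p.2))%:E)); last 2 first.
- exact/measurable_EFinP.
- have mn := strongly_measurable_comp measurable_fun_joint
    strongly_measurable_noise.
  have my := strongly_measurable_comp measurable_fun_coarsen mY.
  apply: integrable_ip => //.
    exact: le_integral_integrable (measurable_sqr_norm mn)
      (fun t => sqr_ge0 _) fresh_variance.
  exact: le_integral_integrable (measurable_sqr_norm my)
      (fun t => sqr_ge0 _) Ym.
apply: integral0_eq => t _.
have [m1 i1 w1] := obj_mean_gradient obj (x t).
have := w1 (Y t); rewrite expectation.unlock => wE.
rewrite /noise /=.
under eq_integral do rewrite (ipDl ip) (ipNl ip) EFinB.
rewrite integralB //; last 2 first.
- apply: le_integrable (integrableZl _ `|Y t|%R i1) => //.
    apply/measurable_EFinP; apply: measurable_ip => //.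
    exact: strongly_measurable_cst.
  move=> y _ /=; rewrite lee_fin normrM !normr_id mulrC.
  exact: normr_ip_le.
- exact: finite_measure_integrable_cst.
rewrite wE integral_cst // [X in _ - _ * X](_ : _ = 1) ?mule1 ?subee //.
exact: (probability_setT PXi).
Qed.

End fresh_sample.

Section minibatch_variance.
Context {R : realType} {H : completeNormedModType R} (ip : {dot H for idfun}).
Hypothesis ip_norm : forall x : H, ip x x = `|x| ^+ 2.

Lemma strongly_measurable_sample dX (Xi : measurableType dX)
    (dF : Xi -> H -> H) d (T : measurableType d) (xi : T -> Xi) (X : T -> H) :
  jointly_measurable dF -> measurable_fun setT xi -> strongly_measurable X ->
  strongly_measurable (fun t => dF (xi t) (X t)).
Proof.
move=> mdF mxi mX.
have mp : measurable_fun setT (fun t => (xi t, t)).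
  by apply: (measurable_fun_pair (g := fun t => t)) => //; exact: measurable_id.
exact: (strongly_measurable_comp mp (mdF _ _ _ mX)).
Qed.

Lemma strongly_measurable_minibatch dX (Xi : measurableType dX)
    (dF : Xi -> H -> H) d (T : measurableType d) B (xi : nat -> T -> Xi)
    (X : T -> H) : jointly_measurable dF ->
  (forall i, (i < B)%N -> measurable_fun setT (xi i)) ->
  strongly_measurable X ->
  strongly_measurable (fun t => minibatch dF B (xi ^~ t) (X t)).
Proof.
move=> mdF mxi mX; apply: strongly_measurableZ.
apply: (strongly_measurable_sum (X := fun i t => dF (xi i t) (X t))) => i iB.
by apply: strongly_measurable_sample => //; exact: mxi.
Qed.

Context d (Om : measurableType d) (P : probability Om R)
  (I : choiceType) (D : set I) (S : I -> set_system Om).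
Hypothesis S_measurable : forall i, S i `<=` measurable.
Hypothesis S_setI : forall i, setI_closed (S i).
Hypothesis S_setT : forall i, S i setT.
Hypothesis S_independent : mutually_independent P D S.
Local Notation sigma E := (g_sigma_algebraType (cylinders S E)).

Lemma measurable_fun_cylinders dX (Xi : measurableType dX) (X : Om -> Xi)
    (E : set I) i : E i -> S i = preimage_set_system setT X measurable ->
  measurable_fun setT (X : sigma E -> Xi).
Proof.
move=> Ei SX _ A mA; apply: sub_sigma_algebra; apply: (cylinders1 S_setT Ei).
by rewrite SX; exists A.
Qed.

Lemma measurable_fun_cylinders_sub (E E' : set I) : E `<=` E' ->
  measurable_fun setT (id : sigma E' -> sigma E).
Proof.
move=> EE' _ A mA; rewrite setTI preimage_id.
by apply: (sub_smallest2r _ (cylinders_sub EE')) mA; exact: smallest_sigma_algebra.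
Qed.

Context dX (Xi : measurableType dX) (PXi : probability Xi R)
  (F : Xi -> H -> R) (dF : Xi -> H -> H) (f : H -> R) (df : H -> H)
  (L sigma2 : R).
Hypothesis obj : smooth_stochastic_objective ip PXi F dF f df L sigma2.
Variables (B : nat) (xi : nat -> {mfun Om >-> Xi}) (label : nat -> I)
  (past : set I).
Hypothesis B_gt0 : (0 < B)%N.
Hypothesis label_inj : injective label.
Hypothesis label_past : forall i, ~ past (label i).
Hypothesis past_drawn : past `<=` D.
Hypothesis label_drawn : forall i, (i < B)%N -> D (label i).
Hypothesis xi_law : forall i, (i < B)%N ->
  forall A, measurable A -> distribution P (xi i) A = PXi A.
Hypothesis xi_generates : forall i,
  S (label i) = preimage_set_system setT (xi i) measurable.
Variable x : sigma past -> H.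
Hypothesis mx : strongly_measurable x.

(** A filtration inside the batch: [past] enlarged by the first [n] samples, with respect to which
    sample number [n] is fresh. *)
Let upto n : set I := past `|` [set label j | j in [set j | (j < n)%N]].
Let noise i w : H := dF (xi i w) (x w) - df (x w).

Let upto_drawn n : (n <= B)%N -> upto n `<=` D.
Proof.
move=> nB l [/past_drawn//|[j /= jn <-]].
by apply: label_drawn; exact: leq_trans jn nB.
Qed.

Let mx_upto n : strongly_measurable (x : sigma (upto n) -> H).
Proof.
apply: (strongly_measurable_comp (X := x)) mx.
by apply: measurable_fun_cylinders_sub => l; left.
Qed.

Let mnoise n i : (i < n)%N ->
  strongly_measurable (noise i : sigma (upto n) -> H).
Proof.
move=> jn; apply: strongly_measurableB.
  apply: strongly_measurable_sample (mx_upto n); first exact: obj_measurable obj.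
  by apply: (measurable_fun_cylinders _ (xi_generates i)); right; exists i.
by apply: strongly_measurable_continuous (mx_upto n); exact: continuous_gradient obj.
Qed.

Let mpartial n :
  strongly_measurable (fun w : sigma (upto n) => \sum_(i < n) noise i w).
Proof. by apply: strongly_measurable_sum => i; exact: mnoise. Qed.

Let measurable_coarsen E : measurable_fun setT (id : Om -> sigma E).
Proof.
have := measurable_fun_coarsen (@cylinders_measurable _ _ _ S S_measurable E).
exact.
Qed.

Let strongly_measurable_Om E (X : sigma E -> H) :
  strongly_measurable X -> strongly_measurable (X : Om -> H).
Proof. exact: (strongly_measurable_comp (@measurable_coarsen E)). Qed.

(** The noises are martingale differences: each new one is centred given [upto n], hence orthogonal
    to the partial sum before it, and variances add. *)
Lemma partial_sum_variance n : (n <= B)%N ->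
  (\int[P]_w (`|\sum_(i < n) noise i w| ^+ 2)%:E <= (n%:R * sigma2)%:E)%E.
Proof.
elim: n => [_|n IH nB].
  under eq_integral do rewrite big_ord0 normr0 expr0n /=.
  by rewrite integral0 mul0r.
under eq_integral do rewrite big_ord_recr /= addrC.
rewrite -natr1 mulrDl mul1r addrC.
have Gm := cylinders_measurable S_measurable (D := upto n).
have law := xi_law nB.
have ind A C : preimage_set_system setT (xi n) measurable A ->
    <<s cylinders S (upto n) >> C -> P (A `&` C) = (P A * P C)%E.
  rewrite -xi_generates => SA sC.
  apply: (cylinders_independent S_measurable S_setI S_setT S_independent
    (D1 := [set label n]) (D2 := upto n)) sC.
  - by move=> _ ->; exact: label_drawn.
  - by apply: upto_drawn; exact: ltnW.
  - apply/seteqP; split=> // _ [-> [/label_past//|[j /= jn /label_inj jE]]].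
    by rewrite jE ltnn in jn.
  - by apply: sub_sigma_algebra; apply: (cylinders1 S_setT) SA.
apply: (second_moment_orthogonalD ip_norm).
(* The new noise uses sample [n], so it is measurable only from [upto n.+1] on. *)
- apply: strongly_measurable_Om; exact: (@mnoise n.+1 n).
- exact: strongly_measurable_Om (mpartial n).
- exact: (fresh_variance Gm law ind obj (mx_upto n)).
- by apply: IH; exact: ltnW.
- apply: (fresh_orthogonal Gm law ind ip_norm obj (mx_upto n) (mpartial n)).
  by apply: IH; exact: ltnW.
Qed.

Lemma minibatch_variance :
  (\int[P]_w (`|minibatch dF B (fun i => xi i w) (x w) - df (x w)| ^+ 2)%:E
     <= (sigma2 / B%:R)%:E)%E.
Proof.
have B0 : B%:R != 0 :> R by rewrite pnatr_eq0 -lt0n.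
under eq_integral => w _.
  have -> : minibatch dF B (fun i => xi i w) (x w) - df (x w) =
      B%:R^-1 *: \sum_(i < B) noise i w.
    rewrite /noise sumrB sumr_const card_ord scalerBr /minibatch.
    by rewrite -[df (x w) *+ B]scaler_nat scalerA mulVf // scale1r.
  over.
apply: le_trans (second_momentZ _ _ (partial_sum_variance (leqnn B))) _.
  exact: strongly_measurable_Om (mpartial B).
by rewrite lee_fin le_eqVlt; apply/orP; left; apply/eqP; field.
Qed.

End minibatch_variance.

(** * The random run *)

Section random_run.
Context {R : realType} {H : completeNormedModType R} (ip : {dot H for idfun}).
Hypothesis ip_norm : forall x : H, ip x x = `|x| ^+ 2.
Context dX dZ (Xi : measurableType dX) (Zt : measurableType dZ).
Variables (dF : Xi -> H -> H) (dG : Zt -> H -> H).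
Hypotheses (mdF : jointly_measurable dF) (mdG : jointly_measurable dG).
Variables (x0 : H) (eta beta rho : nat -> R) (Bf Bg : nat -> nat).
Hypothesis rho_gt0 : forall k, 0 < rho k.

(** The space [T] is arbitrary and only samples drawn before step [k] must be measurable, so the
    lemma serves both on [Om] and on the coarser history. *)
Lemma strongly_measurable_sdbgd d (T : measurableType d)
    (xi : nat -> nat -> T -> Xi) (zeta : nat -> nat -> T -> Zt) k :
  (forall j i, (j < k)%N -> (i < Bf j)%N -> measurable_fun setT (xi j i)) ->
  (forall j i, (j < k)%N -> (i < Bg j)%N -> measurable_fun setT (zeta j i)) ->
  strongly_measurable (fun t => sdbgd ip dF dG x0 eta beta rho Bf Bg
    (fun k i => xi k i t) (fun k i => zeta k i t) k).
Proof.
elim: k => [|k IH] mxi mzeta; first exact: strongly_measurable_cst.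
have mX := IH (fun j i jk => mxi j i (ltnW jk))
  (fun j i jk => mzeta j i (ltnW jk)).
apply: (strongly_measurableB mX); apply: strongly_measurableZ.
by apply: (strongly_measurable_direction ip_norm) => //;
  apply: strongly_measurable_minibatch => // i ik; [exact: mxi|exact: mzeta].
Qed.

Context d (Om : measurableType d) (P : probability Om R).
Variables (xi : nat -> nat -> {mfun Om >-> Xi})
  (zeta : nat -> nat -> {mfun Om >-> Zt}) (N : {mfun Om >-> nat}).
Local Notation S := (generated (P := P) xi zeta N).

Lemma generated_measurable l : S l `<=` measurable.
Proof.
case: l => [[[k i]|[k i]]|] _ /= [A mA <-]; rewrite setTI.
- by rewrite -[X in measurable X]setTI; exact: measurable_funPT.
- by rewrite -[X in measurable X]setTI; exact: measurable_funPT.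
- by rewrite -[X in measurable X]setTI; exact: measurable_funPT.
Qed.

Lemma preimage_set_system_setI (T : Type) dU (U : measurableType dU) (X : T -> U) :
  setI_closed (preimage_set_system setT X measurable).
Proof.
move=> _ _ [A mA <-] [B mB <-]; exists (A `&` B); first exact: measurableI.
by rewrite !setTI preimage_setI.
Qed.

Lemma preimage_set_system_setT (T : Type) dU (U : measurableType dU) (X : T -> U) :
  preimage_set_system setT X measurable setT.
Proof. by exists setT => //; rewrite setTI preimage_setT. Qed.

Lemma generated_setI l : setI_closed (S l).
Proof. by case: l => [[[k i]|[k i]]|] /=; exact: preimage_set_system_setI. Qed.

Lemma generated_setT l : S l setT.
Proof. by case: l => [[[k i]|[k i]]|] /=; exact: preimage_set_system_setT. Qed.

(** Leaving out [None] keeps the random index independent of every iterate. *)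
Definition past (k : nat) : set draw :=
  [set l | match l with
           | Some (inl (j, i)) => (j < k)%N && (i < Bf j)%N
           | Some (inr (j, i)) => (j < k)%N && (i < Bg j)%N
           | None => false
           end].

Local Notation history k := (g_sigma_algebraType (cylinders S (past k))).

Definition iterate (k : nat) (w : Om) : H :=
  sdbgd ip dF dG x0 eta beta rho Bf Bg
    (fun k i => xi k i w) (fun k i => zeta k i w) k.

Lemma measurable_fun_history_xi k j i : (j < k)%N -> (i < Bf j)%N ->
  measurable_fun setT (xi j i : history k -> Xi).
Proof.
move=> jk iB.
apply: (measurable_fun_cylinders generated_setT (i := Some (inl (j, i)))) => //.
by rewrite /past /= jk iB.
Qed.

Lemma measurable_fun_history_zeta k j i : (j < k)%N -> (i < Bg j)%N ->
  measurable_fun setT (zeta j i : history k -> Zt).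
Proof.
move=> jk iB.
apply: (measurable_fun_cylinders generated_setT (i := Some (inr (j, i)))) => //.
by rewrite /past /= jk iB.
Qed.

(** The case [j < k] places all iterates on the single history [K], from which the random index is
    independent. *)
Lemma strongly_measurable_history j k : (j <= k)%N ->
  strongly_measurable (iterate j : history k -> H).
Proof.
move=> jk; apply: strongly_measurable_sdbgd => l i lj iB.
  by apply: measurable_fun_history_xi => //; exact: leq_trans jk.
by apply: measurable_fun_history_zeta => //; exact: leq_trans jk.
Qed.

Lemma strongly_measurable_iterate k : strongly_measurable (iterate k).
Proof. by apply: strongly_measurable_sdbgd => *; exact: measurable_funPT. Qed.

Section sampled.
Variables (PXi : probability Xi R) (PZt : probability Zt R) (K : nat).
Hypothesis sampling : sdbgd_sampling (P := P) PXi PZt K eta beta Bf Bg xi zeta N.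

Lemma past_drawn k : (k <= K)%N -> past k `<=` drawn K Bf Bg.
Proof.
by move=> kK [[[j i]|[j i]]|] //= /andP[jk ->]; rewrite (leq_trans jk kK).
Qed.

Lemma upper_variance (F : Xi -> H -> R) (f : H -> R) (df : H -> H)
    (L sigma2 : R) k :
  smooth_stochastic_objective ip PXi F dF f df L sigma2 -> (k < K)%N ->
  (0 < Bf k)%N ->
  (\int[P]_w (`|minibatch dF (Bf k) (fun i => xi k i w) (iterate k w)
     - df (iterate k w)| ^+ 2)%:E <= (sigma2 / (Bf k)%:R)%:E)%E.
Proof.
move=> obj kK B0.
apply: (minibatch_variance ip_norm generated_measurable generated_setI
  generated_setT (draws_independent sampling) obj B0 (xi := xi k)
  (label := fun i => Some (inl (k, i))) (past := past k)
  _ _ _ _ _ _ (strongly_measurable_history (leqnn k))).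
- by move=> i j [].
- by move=> i /=; rewrite ltnn.
- exact: past_drawn (ltnW kK).
- by move=> i iB /=; rewrite kK iB.
- by move=> i iB; exact: (law_xi sampling).
- by [].
Qed.

Lemma lower_variance (G : Zt -> H -> R) (g : H -> R) (dg : H -> H)
    (L sigma2 : R) k :
  smooth_stochastic_objective ip PZt G dG g dg L sigma2 -> (k < K)%N ->
  (0 < Bg k)%N ->
  (\int[P]_w (`|minibatch dG (Bg k) (fun i => zeta k i w) (iterate k w)
     - dg (iterate k w)| ^+ 2)%:E <= (sigma2 / (Bg k)%:R)%:E)%E.
Proof.
move=> obj kK B0.
apply: (minibatch_variance ip_norm generated_measurable generated_setI
  generated_setT (draws_independent sampling) obj B0 (xi := zeta k)
  (label := fun i => Some (inr (k, i))) (past := past k)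
  _ _ _ _ _ _ (strongly_measurable_history (leqnn k))).
- by move=> i j [].
- by move=> i /=; rewrite ltnn.
- exact: past_drawn (ltnW kK).
- by move=> i iB /=; rewrite kK iB.
- by move=> i iB; exact: (law_zeta sampling).
- by [].
Qed.

End sampled.

End random_run.

(** * Evaluation at the random index *)

Section random_index.
Context {R : realType} d (Om : measurableType d) (P : probability Om R)
  (N : {mfun Om >-> nat}).
Local Open Scope ereal_scope.

Lemma measurable_fun_random_index dU (U : measurableType dU) (h : nat -> Om -> U) :
  (forall k, measurable_fun setT (h k)) -> measurable_fun setT (fun w => h (N w) w).
Proof.
move=> mh _ B mB; rewrite setTI.
have -> : (fun w => h (N w) w) @^-1` B =
    \bigcup_k (N @^-1` [set k] `&` h k @^-1` B).
  by apply/seteqP; split => [w Bw|w [k _ [/= <-]]] //; exists (N w).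
apply: bigcupT_measurable => k; apply: measurableI.
  by rewrite -[X in measurable X]setTI; exact: measurable_funPT.
by rewrite -[X in measurable X]setTI; exact: mh.
Qed.

Variables (G : set_system Om) (K : nat) (p : nat -> R).
Hypothesis G_measurable : G `<=` measurable.
Hypothesis N_independent : forall A B,
  preimage_set_system setT N measurable A -> <<s G >> B ->
  P (A `&` B) = P A * P B.
Hypothesis N_law : forall k, (k < K)%N -> P (N @^-1` [set k]) = (p k)%:E.
Hypothesis p_sum : (\sum_(k < K) p k = 1)%R.
Local Notation OmG := (g_sigma_algebraType G).

(** The index is handled as a fresh sample with values in [nat], its own law playing the role of
    [PXi]. *)
Lemma ge0_integral_event_index k (h : OmG -> R) : (k < K)%N ->
  measurable_fun setT h -> (forall w, 0 <= h w)%R ->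
  \int[P]_w (h w * (N w == k)%:R)%:E = (p k)%:E * \int[P]_w (h w)%:E.
Proof.
move=> kK mh h0.
have mk : measurable_fun setT (fun n : nat => (n == k)%:R : R) by [].
have p0 : (0 <= p k)%R by rewrite -lee_fin -N_law.
rewrite (ge0_integral_fresh G_measurable (PXi := distribution P N) (xi := N) _
  N_independent (h := fun q => (h q.2 * (q.1 == k)%:R)%:E)) //; last 2 first.
- apply/measurable_EFinP; apply: measurable_funM.
    exact: measurableT_comp measurable_snd.
  exact: (measurableT_comp mk measurable_fst).
- by move=> q; rewrite lee_fin mulr_ge0.
have inner t : \int[distribution P N]_n (h t * (n == k)%:R)%:E =
    (p k)%:E * (h t)%:E.
  rewrite ge0_integral_distribution //; last first.
    by move=> n; rewrite lee_fin mulr_ge0.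
  rewrite /=; under eq_integral do rewrite EFinM.
  rewrite ge0_integralZl ?lee_fin //; last first.
    by apply/measurable_EFinP; exact: (measurableT_comp mk).
  rewrite muleC; congr (_ * _).
  have mN : measurable (N @^-1` [set k]).
    by rewrite -[X in measurable X]setTI; exact: measurable_funPT.
  rewrite -N_law // -(setIT (N @^-1` [set k])) -integral_indic //.
  by apply: eq_integral => w _; rewrite indicE;
    congr ((nat_of_bool _)%:R%:E); apply/eqP/idP; rewrite inE.
under eq_integral do rewrite inner.
rewrite ge0_integralZl ?lee_fin //; last first.
- by move=> t _; rewrite lee_fin.
- exact/measurable_EFinP.
by rewrite ge0_integral_distribution //; exact/measurable_EFinP.
Qed.

(** The law of [N] is prescribed only below [K], but these weights already sum to 1, so larger
    values form a null event. *)
Lemma ae_index_lt : {ae P, forall w, (N w < K)%N}.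
Proof.
have mN k : measurable (N @^-1` [set k]).
  by rewrite -[X in measurable X]setTI; exact: measurable_funPT.
pose A := \bigcup_(k < K) N @^-1` [set k].
have mA : measurable A by apply: bigcup_measurable => k _.
have AE : A = [set w | (N w < K)%N].
  apply/seteqP; split => [w [k /= kK NK]|w /= NK]; first by rewrite NK.
  by exists (N w).
have PA : P A = 1.
  have tN : trivIset setT (fun k => N @^-1` [set k]).
    apply/trivIsetP => i j _ _ ij; apply/seteqP; split => // w [/= -> /eqP].
    by rewrite (negbTE ij).
  rewrite /A bigcup_mkord (measure_bigsetU P mN tN).
  rewrite -p_sum -sumEFin; apply: eq_bigr => k _; exact: N_law.
exists (~` A); split; first exact: measurableC.
  by rewrite probability_setC // PA subee.
by rewrite AE.
Qed.

(** Measurability on [Om] is asked for every [k], as [N] may exceed [K] on a null event; dependence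
    on the past alone is needed only where the weights live. *)
Lemma ge0_integral_random_index (h : nat -> Om -> R) :
  (forall k, (k < K)%N -> measurable_fun setT (h k : OmG -> R)) ->
  (forall k, measurable_fun setT (h k)) -> (forall k w, 0 <= h k w)%R ->
  \int[P]_w (h (N w) w)%:E = \sum_(k < K) (p k)%:E * \int[P]_w (h k w)%:E.
Proof.
move=> mhG mh h0.
have mk k : measurable_fun setT (fun w => (N w == k)%:R : R).
  have mk' : measurable_fun setT (fun n : nat => (n == k)%:R : R) by [].
  exact: (measurableT_comp mk').
have mhk (k : nat) : measurable_fun setT (fun w => (h k w * (N w == k)%:R)%:E).
  by apply/measurable_EFinP; exact: measurable_funM.
have hk0 (k : nat) w : 0 <= (h k w * (N w == k)%:R)%:E.
  by rewrite lee_fin mulr_ge0.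
transitivity (\int[P]_w \sum_(k < K) (h k w * (N w == k)%:R)%:E).
  apply: ge0_ae_eq_integral => //.
  - by apply/measurable_EFinP; exact: measurable_fun_random_index.
  - by apply: emeasurable_sum => k.
  - by move=> w _; rewrite lee_fin.
  - by move=> w _; apply: sume_ge0.
  - apply: filterS ae_index_lt => w NK _.
    rewrite (bigD1 (Ordinal NK)) //= eqxx mulr1 big1 ?adde0 // => k kN.
    by rewrite [_ == _](_ : _ = false) ?mulr0 //; apply/negbTE; rewrite eq_sym.
rewrite ge0_integral_sum //.
by apply: eq_bigr => k _; apply: ge0_integral_event_index => //; exact: mhG.
Qed.

End random_index.

(** * Expected stationarity *)

(** All summands are nonnegative, so a pathwise inequality can be integrated in the extended reals
    without any prior integrability. *)
Lemma average_expectation_le {R : realType} d (Om : measurableType d)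
    (P : probability Om R) (K : nat) (h a b : nat -> Om -> R)
    (A al ga m1 m2 : R) : (0 < K)%N ->
  (forall k, measurable_fun setT (h k)) ->
  (forall k, measurable_fun setT (a k)) ->
  (forall k, measurable_fun setT (b k)) ->
  (forall k w, 0 <= h k w) -> (forall k w, 0 <= a k w) ->
  (forall k w, 0 <= b k w) -> 0 <= A -> 0 <= al -> 0 <= ga ->
  (forall w, \sum_(k < K) h k w <=
     A + al * (\sum_(k < K) a k w) + ga * (\sum_(k < K) b k w)) ->
  (forall k, (k < K)%N -> \int[P]_w (a k w)%:E <= m1%:E)%E ->
  (forall k, (k < K)%N -> \int[P]_w (b k w)%:E <= m2%:E)%E ->
  (\sum_(k < K) (K%:R^-1)%:E * \int[P]_w (h k w)%:E <=
     (A / K%:R + al * m1 + ga * m2)%:E)%E.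
Proof.
move=> K0 mh ma mb h0 a0 b0 A0 bias ga0 hle am bm.
have KR : 0 < K%:R :> R by rewrite ltr0n.
have msum (g : nat -> Om -> R) : (forall k, measurable_fun setT (g k)) ->
    measurable_fun setT (fun w => (\sum_(k < K) g k w)%:E).
  by move=> mg; apply/measurable_EFinP; apply: measurable_sum => k; exact: mg.
have sum0 (g : nat -> Om -> R) : (forall k w, 0 <= g k w) ->
    forall w, 0 <= \sum_(k < K) g k w by move=> g0 w; exact: sumr_ge0.
have intsum (g : nat -> Om -> R) : (forall k, measurable_fun setT (g k)) ->
    (forall k w, 0 <= g k w) -> (\int[P]_w (\sum_(k < K) g k w)%:E =
    \sum_(k < K) \int[P]_w (g k w)%:E)%E.
  move=> mg g0; under eq_integral do rewrite -sumEFin.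
  rewrite (ge0_integral_sum _ _ (f := fun (k : 'I_K) w => (g k w)%:E)) //.
    by move=> k; exact/measurable_EFinP.
  by move=> k w _; rewrite lee_fin.
have bound (g : nat -> Om -> R) m : (forall k, measurable_fun setT (g k)) ->
    (forall k w, 0 <= g k w) ->
    (forall k, (k < K)%N -> \int[P]_w (g k w)%:E <= m%:E)%E ->
    (\int[P]_w (\sum_(k < K) g k w)%:E <= (K%:R * m)%:E)%E.
  move=> mg g0 gm; rewrite intsum //.
  apply: (@le_trans _ _ (\sum_(k < K) m%:E)%E).
    by apply: lee_sum => k _; exact: gm.
  by rewrite sumEFin sumr_const card_ord mulr_natl.
have main : (\int[P]_w (\sum_(k < K) h k w)%:E <=
    (A + al * (K%:R * m1) + ga * (K%:R * m2))%:E)%E.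
  apply: (@le_trans _ _ (\int[P]_w (A%:E + al%:E * (\sum_(k < K) a k w)%:E
      + ga%:E * (\sum_(k < K) b k w)%:E))%E).
    apply: ge0_le_integral => //.
    - by move=> w _; rewrite lee_fin sum0.
    - exact: msum.
    - apply: emeasurable_funD; last by apply: measurable_funeM; exact: msum.
      by apply: emeasurable_funD => //; apply: measurable_funeM; exact: msum.
    - by move=> w _; rewrite -!EFinM -!EFinD lee_fin.
  have ma' : measurable_fun setT (fun w => al%:E * (\sum_(k < K) a k w)%:E)%E.
    by apply: measurable_funeM; exact: msum.
  have mb' : measurable_fun setT (fun w => ga%:E * (\sum_(k < K) b k w)%:E)%E.
    by apply: measurable_funeM; exact: msum.
  have pa w : (0 <= al%:E * (\sum_(k < K) a k w)%:E)%E.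
    by rewrite lee_fin mulr_ge0 // sum0.
  have pb w : (0 <= ga%:E * (\sum_(k < K) b k w)%:E)%E.
    by rewrite lee_fin mulr_ge0 // sum0.
  rewrite ge0_integralD //; last 2 first.
  - by move=> w _; rewrite adde_ge0.
  - exact: emeasurable_funD.
  rewrite ge0_integralD //.
  rewrite (ge0_integralZl P measurableT (msum a ma)) ?lee_fin //; last first.
    by move=> w _; rewrite lee_fin sum0.
  rewrite (ge0_integralZl P measurableT (msum b mb)) ?lee_fin //; last first.
    by move=> w _; rewrite lee_fin sum0.
  rewrite integral_cst // [X in (_ * X + _ + _)%E](_ : _ = 1%E) ?mule1; last first.
    exact: (probability_setT P).
  rewrite !EFinD; apply: leeD; first apply: leeD => //.
    by rewrite EFinM lee_wpmul2l ?lee_fin //; exact: bound.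
  by rewrite EFinM lee_wpmul2l ?lee_fin //; exact: bound.
rewrite -ge0_sume_distrr; last first.
  by move=> k _; apply: integral_ge0 => w _; rewrite lee_fin.
rewrite -intsum //.
apply: (@le_trans _ _
  ((K%:R^-1)%:E * (A + al * (K%:R * m1) + ga * (K%:R * m2))%:E)%E).
  by rewrite lee_wpmul2l // lee_fin invr_ge0 ltW.
by rewrite -EFinM lee_fin le_eqVlt; apply/orP; left; apply/eqP; field;
  rewrite gt_eqF.
Qed.

Section run_bound.
Context {R : realType} {H : completeNormedModType R} (ip : {dot H for idfun}).
Hypothesis ip_norm : forall x : H, ip x x = `|x| ^+ 2.
Context dX dZ (Xi : measurableType dX) (Zt : measurableType dZ)
  (PXi : probability Xi R) (PZt : probability Zt R).
Variables (F : Xi -> H -> R) (dF : Xi -> H -> H) (f : H -> R) (df : H -> H)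
  (G : Zt -> H -> R) (dG : Zt -> H -> H) (g : H -> R) (dg : H -> H)
  (Lf Lg Gf sigma2f sigma2g : R).
Hypothesis upper : smooth_stochastic_objective ip PXi F dF f df Lf sigma2f.
Hypothesis lower : smooth_stochastic_objective ip PZt G dG g dg Lg sigma2g.
Variables (mf mg : R).
Hypotheses (mf_le : forall x, mf <= f x) (mg_le : forall x, mg <= g x).
Hypothesis df_bounded : forall x, `|df x| <= Gf.
Variables (x0 : H) (eta beta t c : R) (Bf Bg K : nat).
Hypotheses (beta_gt0 : 0 < beta) (t_gt0 : 0 < t) (eta_gt0 : 0 < eta)
  (c_gt0 : 0 < c).
Hypotheses (eta_le : Lf * eta <= 2^-1) (c_le : c * Lg * eta <= beta / 4)
  (beta_le : beta ^+ 2 <= c / 4).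
Hypotheses (Bf_gt0 : (0 < Bf)%N) (Bg_gt0 : (0 < Bg)%N) (K_gt0 : (0 < K)%N).
Context d (Om : measurableType d) (P : probability Om R)
  (xi : nat -> nat -> {mfun Om >-> Xi}) (zeta : nat -> nat -> {mfun Om >-> Zt})
  (N : {mfun Om >-> nat}).
Hypothesis sampling : sdbgd_sampling (P := P) PXi PZt K (fun=> eta) (fun=> beta)
  (fun=> Bf) (fun=> Bg) xi zeta N.

Local Notation X := (iterate ip dF dG x0 (fun=> eta) (fun=> beta)
  (fun=> t ^+ 2) (fun=> Bf) (fun=> Bg) xi zeta).
Let u k w := minibatch dF Bf (fun i => xi k i w) (X k w).
Let v k w := minibatch dG Bg (fun i => zeta k i w) (X k w).
Local Notation lam := (multiplier ip beta (t ^+ 2)).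
Let dir k w : H := u k w + lam (u k w) (v k w) *: v k w.
Let errf k w := `|u k w - df (X k w)| ^+ 2.
Let errg k w := `|v k w - dg (X k w)| ^+ 2.
(* Unlike the multiplier of the algorithm it uses the exact upper gradient, which
   makes it bounded by a constant. *)
Definition shadow_multiplier k w := lam (df (X k w)) (v k w).
Let stat k w := `|df (X k w) + shadow_multiplier k w *: dg (X k w)| ^+ 2.
Let low k w := `|dg (X k w)| ^+ 2.

Definition initial_gap := ((f x0 - mf) / eta + c * ((g x0 - mg) / (eta * beta))).
(** The remainder of [combined_step] sorted by source: its deterministic part here, then the
    coefficients of the upper and lower squared errors. *)
Definition bias := 2 * beta ^+ 2 / c * Gf ^+ 2 + c * t ^+ 2
  + c * (t / (2 * beta)) * (Gf + 1).
Definition upper_noise := 2 * beta ^+ 2 / c + 2 + c * (t / (2 * beta)).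
Definition lower_noise := 2 * c ^+ 2 / beta ^+ 2.

Lemma pathwise_sum w :
  \sum_(k < K) (c / 2 * `|v k w| ^+ 2 + 3 / 8 * `|dir k w| ^+ 2) <=
  initial_gap + K%:R * bias + upper_noise * (\sum_(k < K) errf k w)
    + lower_noise * (\sum_(k < K) errg k w).
Proof.
have step k : c / 2 * `|v k w| ^+ 2 + 3 / 8 * `|dir k w| ^+ 2 <=
    (f (X k w) - f (X k.+1 w)) / eta
    + c * ((g (X k w) - g (X k.+1 w)) / (eta * beta))
    + bias + upper_noise * errf k w + lower_noise * errg k w.
  have := combined_step ip_norm (obj_gradient upper)
    (obj_gradient lower) (obj_lipschitz upper) (obj_lipschitz lower)
    df_bounded beta_gt0 t_gt0 eta_gt0 c_gt0 eta_le c_le beta_le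
    (X k w) (u k w) (v k w).
  (* The update folds back into the next iterate, so that the differences telescope. *)
  rewrite -/(X k.+1 w) -/(dir k w) => /le_trans; apply.
  rewrite -/(errf k w) -/(errg k w) /bias /upper_noise /lower_noise.
  by rewrite le_eqVlt; apply/orP; left; apply/eqP; ring.
(* The induction keeps the last values of f and g; the lower bounds [mf] and [mg] enter once, at the
   end. *)
suff tele n : \sum_(k < n) (c / 2 * `|v k w| ^+ 2 + 3 / 8 * `|dir k w| ^+ 2) <=
    (f x0 - f (X n w)) / eta + c * ((g x0 - g (X n w)) / (eta * beta))
    + n%:R * bias + upper_noise * (\sum_(k < n) errf k w)
    + lower_noise * (\sum_(k < n) errg k w).
  apply: le_trans (tele K) _; rewrite !lerD2r /initial_gap lerD //.
    apply: ler_wpM2r; first by rewrite invr_ge0 ltW.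
    by rewrite lerD2l lerN2.
  apply: ler_wpM2l; first exact: ltW.
  apply: ler_wpM2r; first by rewrite invr_ge0 ltW // mulr_gt0.
  by rewrite lerD2l lerN2.
elim: n => [|n IH].
  by rewrite !big_ord0 /= !subrr !mul0r !mulr0 !addr0.
rewrite !big_ord_recr /= -[n.+1%:R]natr1.
by have := step n; lra.
Qed.

Lemma initial_gap_ge0 : 0 <= initial_gap.
Proof.
have e0 := ltW eta_gt0; have c0 := ltW c_gt0; have be0 := ltW beta_gt0.
apply: addr_ge0; first by rewrite divr_ge0 // subr_ge0.
by rewrite mulr_ge0 // divr_ge0 ?subr_ge0 // mulr_ge0.
Qed.

Let Gf_ge0 : 0 <= Gf.
Proof. exact: le_trans (normr_ge0 _) (df_bounded x0). Qed.

Lemma step_coefs_ge0 : [/\ 0 <= bias, 0 <= upper_noise & 0 <= lower_noise].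
Proof.
have c0 := ltW c_gt0; have be0 := ltW beta_gt0; have t0 := ltW t_gt0.
have b2 : 0 <= 2 * beta ^+ 2 / c by rewrite divr_ge0 // mulr_ge0 // sqr_ge0.
have ct : 0 <= c * (t / (2 * beta)).
  by rewrite mulr_ge0 // divr_ge0 // mulr_ge0.
have g1 : 0 <= Gf + 1 by rewrite addr_ge0.
split; rewrite /bias /upper_noise /lower_noise.
- by rewrite !addr_ge0 // mulr_ge0 // sqr_ge0.
- by rewrite !addr_ge0.
- by rewrite divr_ge0 ?mulr_ge0 ?sqr_ge0.
Qed.

Let weights : (\sum_(k < K) K%:R^-1 = 1 :> R).
Proof.
by rewrite sumr_const card_ord -[LHS]mulr_natl divff // pnatr_eq0 -lt0n.
Qed.

Let index_law k : (k < K)%N -> P (N @^-1` [set k]) = (K%:R^-1)%:E.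
Proof.
move=> kK; rewrite (law_index sampling kK) sumr_const card_ord -[X in _ / X]mulr_natl.
congr (_%:E); have KR : K%:R != 0 :> R by rewrite pnatr_eq0 -lt0n.
by field; rewrite KR !gt_eqF.
Qed.

Local Notation S := (generated (P := P) xi zeta N).
Local Notation hist := (past (fun=> Bf) (fun=> Bg)).
Local Notation history := (g_sigma_algebraType (cylinders S (hist K))).

Let rho_gt0 (k : nat) : 0 < t ^+ 2. Proof. by rewrite exprn_gt0. Qed.

Let index_independent A B : preimage_set_system setT N measurable A ->
  <<s cylinders S (hist K) >> B -> P (A `&` B) = (P A * P B)%E.
Proof.
move=> NA HB.
have gm l : S l `<=` measurable by exact: generated_measurable.
have gI l : setI_closed (S l) by exact: generated_setI.
have gT l : S l setT by exact: generated_setT.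
apply: (cylinders_independent gm gI gT (draws_independent sampling)
  (D1 := [set None])) HB.
- by move=> _ ->.
- exact: past_drawn.
- by apply/seteqP; split => // l [-> ].
- apply: sub_sigma_algebra.
  have N1 : [set (None : draw)] None by [].
  exact: (cylinders1 gT N1).
Qed.

Section measurability.
Context d' (T : measurableType d') (j : T -> Om) (k : nat).
Hypothesis mX : strongly_measurable (X k \o j).
Hypothesis mxi : forall i, (i < Bf)%N -> measurable_fun setT (xi k i \o j).
Hypothesis mzeta : forall i, (i < Bg)%N -> measurable_fun setT (zeta k i \o j).

(** The map [j] will be the identity, from [Om] itself or from the coarser [history]: [stat] and
    [low] need both versions. *)
Let mu : strongly_measurable (u k \o j).
Proof.
exact: (strongly_measurable_minibatch (xi := fun i t => xi k i (j t))
  (obj_measurable upper) mxi mX).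
Qed.

Let mv : strongly_measurable (v k \o j).
Proof.
exact: (strongly_measurable_minibatch (xi := fun i t => zeta k i (j t))
  (obj_measurable lower) mzeta mX).
Qed.

Let mdfX : strongly_measurable (fun w => df (X k (j w))).
Proof. exact: (strongly_measurable_continuous (continuous_gradient upper) mX). Qed.

Let mdgX : strongly_measurable (fun w => dg (X k (j w))).
Proof. exact: (strongly_measurable_continuous (continuous_gradient lower) mX). Qed.

Lemma measurable_errf : measurable_fun setT (errf k \o j).
Proof. exact: measurable_sqr_norm (strongly_measurableB mu mdfX). Qed.

Lemma measurable_errg : measurable_fun setT (errg k \o j).
Proof. exact: measurable_sqr_norm (strongly_measurableB mv mdgX). Qed.

Lemma measurable_low : measurable_fun setT (low k \o j).
Proof. exact: measurable_sqr_norm mdgX. Qed.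

Lemma measurable_shadow_multiplier :
  measurable_fun setT (shadow_multiplier k \o j).
Proof. exact: (measurable_multiplier ip_norm _ (rho_gt0 0) mdfX mv). Qed.

(** Expanding the square leaves only products of real functions, so real measurability of the
    multiplier is enough. *)
Lemma measurable_stat : measurable_fun setT (stat k \o j).
Proof.
have mm := measurable_shadow_multiplier.
have -> : stat k \o j = fun w => `|df (X k (j w))| ^+ 2
    + 2 * (shadow_multiplier k (j w) * ip (df (X k (j w))) (dg (X k (j w))))
    + shadow_multiplier k (j w) ^+ 2 * `|dg (X k (j w))| ^+ 2.
  apply/funext => w; rewrite /stat /= (sqr_normD ip_norm) (ipZr ip) normrZ.
  by rewrite exprMn real_normK ?num_real.
apply: measurable_funD; first apply: measurable_funD.
- exact: measurable_sqr_norm mdfX.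
- apply: measurable_funM => //; apply: measurable_funM => //.
  exact: (measurable_ip ip_norm mdfX mdgX).
- apply: measurable_funM; last exact: measurable_sqr_norm mdgX.
  exact: measurable_funX.
Qed.

End measurability.

Let mX_Om k : strongly_measurable (X k).
Proof.
exact: (strongly_measurable_iterate ip_norm (obj_measurable upper)
  (obj_measurable lower)).
Qed.

Let mX_history k : (k <= K)%N -> strongly_measurable (X k : history -> H).
Proof.
exact: (strongly_measurable_history ip_norm (obj_measurable upper)
  (obj_measurable lower)).
Qed.

Let mxi_Om k i : (i < Bf)%N -> measurable_fun setT (xi k i).
Proof. by move=> _; exact: measurable_funPT. Qed.

Let mzeta_Om k i : (i < Bg)%N -> measurable_fun setT (zeta k i).
Proof. by move=> _; exact: measurable_funPT. Qed.

Let mzeta_history k i : (k < K)%N -> (i < Bg)%N ->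
  measurable_fun setT (zeta k i : history -> Zt).
Proof. by move=> kK iB; exact: measurable_fun_history_zeta. Qed.

Lemma measurable_random_shadow_multiplier :
  measurable_fun setT (fun w => shadow_multiplier (N w) w).
Proof.
apply: measurable_fun_random_index => k.
exact: (measurable_shadow_multiplier (j := id) (mX_Om k) (@mzeta_Om k)).
Qed.

Lemma measurable_random_stationarity : measurable_fun setT (fun w => stat (N w) w).
Proof.
apply: measurable_fun_random_index => k.
exact: (measurable_stat (j := id) (mX_Om k) (@mzeta_Om k)).
Qed.

Lemma measurable_random_lower_stationarity :
  measurable_fun setT (fun w => low (N w) w).
Proof.
apply: measurable_fun_random_index => k.
exact: (measurable_low (j := id) (mX_Om k)).
Qed.

Let errf_le k : (k < K)%N ->
  (\int[P]_w (errf k w)%:E <= (sigma2f / Bf%:R)%:E)%E.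
Proof.
move=> kK; exact: (upper_variance ip_norm (obj_measurable upper)
  (obj_measurable lower) x0 rho_gt0 sampling upper kK Bf_gt0).
Qed.

Let errg_le k : (k < K)%N ->
  (\int[P]_w (errg k w)%:E <= (sigma2g / Bg%:R)%:E)%E.
Proof.
move=> kK; exact: (lower_variance ip_norm (obj_measurable upper)
  (obj_measurable lower) x0 rho_gt0 sampling lower kK Bg_gt0).
Qed.

Let random_index_average (h : nat -> Om -> R) (A al ga : R) :
  (forall k, (k < K)%N -> measurable_fun setT (h k : history -> R)) ->
  (forall k, measurable_fun setT (h k)) -> (forall k w, 0 <= h k w) ->
  0 <= A -> 0 <= al -> 0 <= ga ->
  (forall w, \sum_(k < K) h k w <=
     A + al * (\sum_(k < K) errf k w) + ga * (\sum_(k < K) errg k w)) ->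
  (\int[P]_w (h (N w) w)%:E <=
   (A / K%:R + al * (sigma2f / Bf%:R) + ga * (sigma2g / Bg%:R))%:E)%E.
Proof.
move=> mhG mh h0 A0 al_ge ga0 hle.
have Gm : cylinders S (hist K) `<=` measurable.
  by apply: cylinders_measurable => l; exact: generated_measurable.
rewrite (ge0_integral_random_index Gm index_independent index_law weights mhG mh h0).
apply: (average_expectation_le K_gt0 mh _ _ h0 _ _ A0 al_ge ga0 hle).
- by move=> k; exact: (measurable_errf (j := id) (mX_Om k) (@mxi_Om k)).
- by move=> k; exact: (measurable_errg (j := id) (mX_Om k) (@mzeta_Om k)).
- by move=> k w; exact: sqr_ge0.
- by move=> k w; exact: sqr_ge0.
- exact: errf_le.
- exact: errg_le.
Qed.

Lemma expected_stationarity :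
  (\int[P]_w (`|df (X (N w) w) + shadow_multiplier (N w) w *: dg (X (N w) w)| ^+ 2)%:E
   <= (8 * (initial_gap + K%:R * bias) / K%:R + (8 * upper_noise + 12) * (sigma2f / Bf%:R)
       + (8 * lower_noise + 3 * (beta + Gf / (2 * t)) ^+ 2) * (sigma2g / Bg%:R))%:E)%E.
Proof.
have [a0 a1 a2] := step_coefs_ge0; have g0 := initial_gap_ge0.
apply: (random_index_average (h := stat)).
- move=> k kK; apply: (measurable_stat (j := id : history -> Om)).
  + exact: mX_history (ltnW kK).
  + by move=> i; exact: mzeta_history.
- by move=> k; exact: (measurable_stat (j := id) (mX_Om k) (@mzeta_Om k)).
- by move=> k w; exact: sqr_ge0.
- by rewrite mulr_ge0 // addr_ge0 // mulr_ge0.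
- by rewrite addr_ge0 // mulr_ge0.
- by rewrite addr_ge0 // mulr_ge0 // sqr_ge0.
move=> w; set Lam := (beta + _) ^+ 2.
(* The weight 8 turns [3/8 |d|^2] into the [3 |d|^2] of [stationarity_step]; the nonnegative [|v|^2]
   part is dropped. *)
have step k : stat k w <= 8 * (c / 2 * `|v k w| ^+ 2 + 3 / 8 * `|dir k w| ^+ 2)
    + 12 * errf k w + 3 * Lam * errg k w.
  have := stationarity_step ip_norm dg df_bounded beta_gt0 t_gt0
    (X k w) (u k w) (v k w).
  rewrite -/(shadow_multiplier k w) -/(stat k w) -/(errf k w) -/(errg k w) -/Lam.
  rewrite -/(dir k w).
  have : 0 <= c * `|v k w| ^+ 2 by rewrite mulr_ge0 ?sqr_ge0 // ltW.
  by have := sqr_ge0 `|dir k w|; lra.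
apply: (@le_trans _ _ (\sum_(k < K) (8 * (c / 2 * `|v k w| ^+ 2
  + 3 / 8 * `|dir k w| ^+ 2) + 12 * errf k w + 3 * Lam * errg k w))).
  by apply: ler_sum => k _; exact: step.
rewrite !big_split /= -!mulr_sumr.
by have := pathwise_sum w; rewrite big_split /= -!mulr_sumr; lra.
Qed.

Lemma expected_lower_stationarity :
  (\int[P]_w (`|dg (X (N w) w)| ^+ 2)%:E
   <= (4 / c * (initial_gap + K%:R * bias) / K%:R + 4 / c * upper_noise * (sigma2f / Bf%:R)
       + (4 / c * lower_noise + 2) * (sigma2g / Bg%:R))%:E)%E.
Proof.
have [a0 a1 a2] := step_coefs_ge0; have g0 := initial_gap_ge0.
have c0 : 0 <= 4 / c by rewrite divr_ge0 // ltW.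
apply: (random_index_average (h := low)).
- move=> k kK; apply: (measurable_low (j := id : history -> Om)).
  exact: mX_history (ltnW kK).
- by move=> k; exact: (measurable_low (j := id) (mX_Om k)).
- by move=> k w; exact: sqr_ge0.
- by rewrite mulr_ge0 // addr_ge0 // mulr_ge0.
- by rewrite mulr_ge0.
- by rewrite addr_ge0 // mulr_ge0.
move=> w.
(* The weight [4 / c] turns [c/2 |v|^2] into the required [2 |v|^2], and the direction part is
   dropped. *)
have step k : low k w <= 4 / c * (c / 2 * `|v k w| ^+ 2
    + 3 / 8 * `|dir k w| ^+ 2) + 2 * errg k w.
  have := lower_stationarity_step dg (X k w) (v k w).
  rewrite -/(low k w) -/(errg k w).
  have : 0 <= 4 / c * (3 / 8 * `|dir k w| ^+ 2) by rewrite mulr_ge0 // mulr_ge0 // sqr_ge0.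
  have -> : 4 / c * (c / 2 * `|v k w| ^+ 2 + 3 / 8 * `|dir k w| ^+ 2) =
    2 * `|v k w| ^+ 2 + 4 / c * (3 / 8 * `|dir k w| ^+ 2).
    by field; rewrite gt_eqF.
  by lra.
apply: (@le_trans _ _ (\sum_(k < K) (4 / c * (c / 2 * `|v k w| ^+ 2
  + 3 / 8 * `|dir k w| ^+ 2) + 2 * errg k w))).
  by apply: ler_sum => k _; exact: step.
rewrite big_split /= -!mulr_sumr.
by have := ler_wpM2l c0 (pathwise_sum w); lra.
Qed.

End run_bound.

(** * Scaling in the horizon *)

Section schedule_scale.
Context {R : realType}.

(* K^(-1/4), the common scale of all the parameters of the run of horizon K. *)
Definition scale (K : nat) : R := K%:R `^ (- 4^-1).

Lemma scale_gt0 K : (1 <= K)%N -> 0 < scale K.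
Proof. by move=> K0; rewrite powR_gt0 // ltr0n. Qed.

Lemma scaleX4 K : (1 <= K)%N -> scale K ^+ 4 = K%:R^-1.
Proof.
move=> K0; rewrite /scale -powR_mulrn ?powR_ge0 // -powRrM.
by rewrite mulNr mulVf ?pnatr_eq0 // powR_inv1 // ler0n.
Qed.

Lemma scale_le1 K : (1 <= K)%N -> scale K <= 1.
Proof.
move=> K0; rewrite -(@expr_le1 _ 4) ?(ltW (scale_gt0 K0)) // scaleX4 //.
by rewrite invf_le1 ?ltr0n // ler1n.
Qed.

Lemma scaleN4 K : (1 <= K)%N -> K%:R = scale K ^- 4.
Proof. by move=> K0; rewrite scaleX4 // invrK. Qed.

(** From [c y < B + 1 <= 2 B]; the factor 2 is the price of rounding. *)
Lemma batch_propto_inv (c y : R) B : 0 < c -> 0 < y -> batch_propto c y B ->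
  B%:R^-1 <= 2 / (c * y).
Proof.
move=> c0 y0 [B1]; rewrite ltr_norml => /andP[lo _].
have BR : 1 <= B%:R :> R by rewrite ler1n.
rewrite ler_pdivlMr ?mulr_gt0 // mulrC ler_pdivrMr; last by rewrite ltr0n.
by lra.
Qed.

Lemma batch_propto_le (c y : R) B : batch_propto c y B -> B%:R <= c * y + 1.
Proof. by move=> [_]; rewrite ltr_norml => /andP[_ hi]; lra. Qed.

End schedule_scale.

Section scaled_bounds.
Context {R : realType} {H : completeNormedModType R}.
Variables (f g : H -> R) (x0 : H) (mf mg Gf a b t c s : R).
Hypotheses (a_gt0 : 0 < a) (b_gt0 : 0 < b) (t_gt0 : 0 < t) (c_gt0 : 0 < c).
Hypotheses (s_gt0 : 0 < s) (s_le1 : s <= 1).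
Hypotheses (f_ge : mf <= f x0) (g_ge : mg <= g x0) (Gf_ge0 : 0 <= Gf).
Variables (K : nat).
Hypothesis KE : K%:R = s ^- 4.

(** These four constants are the coefficients of the run bound at [s = 1], that is [K = 1]. Here [b]
    and [t] are the constants of [beta] and [sqrt rho] relative to [s] and [s^3], not those of the
    schedule. *)
Definition scaled_bias := (f x0 - mf) / a + c * ((g x0 - mg) / (a * b))
  + 2 * b ^+ 2 / c * Gf ^+ 2 + c * t ^+ 2 + c * (t / (2 * b)) * (Gf + 1).
Definition scaled_upper_noise := 2 * b ^+ 2 / c + 2 + c * (t / (2 * b)).
Definition scaled_lower_noise := 2 * c ^+ 2 / b ^+ 2.
Definition scaled_multiplier_bound := (b + Gf / (2 * t)) ^+ 2.

Let s0 : s != 0. Proof. by rewrite gt_eqF. Qed.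
Let a0 : a != 0. Proof. by rewrite gt_eqF. Qed.
Let b0 : b != 0. Proof. by rewrite gt_eqF. Qed.
Let t0 : t != 0. Proof. by rewrite gt_eqF. Qed.
Let c0 : c != 0. Proof. by rewrite gt_eqF. Qed.

Let pow_le n m : (m <= n)%N -> s ^+ n <= s ^+ m.
Proof. by move=> mn; apply: ler_wiXn2l => //; exact: ltW. Qed.

Lemma scaled_bias_le :
  (initial_gap f g mf mg x0 (a * s) (b * s) c + K%:R * bias Gf (b * s) (t * s ^+ 3) c)
    / K%:R <= scaled_bias * s ^+ 2.
Proof.
have -> : (initial_gap f g mf mg x0 (a * s) (b * s) c
    + K%:R * bias Gf (b * s) (t * s ^+ 3) c) / K%:R =
  (f x0 - mf) / a * s ^+ 3 + c * ((g x0 - mg) / (a * b)) * s ^+ 2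
  + 2 * b ^+ 2 / c * Gf ^+ 2 * s ^+ 2 + c * t ^+ 2 * s ^+ 6
  + c * (t / (2 * b)) * (Gf + 1) * s ^+ 2.
  by rewrite /initial_gap /bias KE; field; rewrite s0 a0 b0 c0.
have h1 : 0 <= (f x0 - mf) / a by rewrite divr_ge0 ?subr_ge0 // ltW.
have h2 : 0 <= c * t ^+ 2 by rewrite mulr_ge0 ?sqr_ge0 // ltW.
have := ler_wpM2l h1 (pow_le (isT : (2 <= 3)%N)).
have := ler_wpM2l h2 (pow_le (isT : (2 <= 6)%N)).
by rewrite /scaled_bias; lra.
Qed.

Lemma scaled_upper_noise_le : upper_noise (b * s) (t * s ^+ 3) c <= scaled_upper_noise.
Proof.
have -> : upper_noise (b * s) (t * s ^+ 3) c = 2 * b ^+ 2 / c * s ^+ 2 + 2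
    + c * (t / (2 * b)) * s ^+ 2.
  by rewrite /upper_noise; field; rewrite s0 b0 c0.
have h1 : 0 <= 2 * b ^+ 2 / c by rewrite divr_ge0 ?(ltW c_gt0) // mulr_ge0 // sqr_ge0.
have h2 : 0 <= c * (t / (2 * b)) by rewrite ltW // mulr_gt0 ?divr_gt0 ?mulr_gt0.
have := ler_wpM2l h1 (pow_le (isT : (0 <= 2)%N)).
have := ler_wpM2l h2 (pow_le (isT : (0 <= 2)%N)).
by rewrite /scaled_upper_noise expr0; lra.
Qed.

Lemma scaled_lower_noise_le : lower_noise (b * s) c * s ^+ 10 <= scaled_lower_noise * s ^+ 2.
Proof.
have -> : lower_noise (b * s) c * s ^+ 10 = scaled_lower_noise * s ^+ 8.
  by rewrite /lower_noise /scaled_lower_noise; field; rewrite s0 b0.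
rewrite ler_wpM2l ?pow_le //.
by rewrite divr_ge0 ?sqr_ge0 // mulr_ge0 // sqr_ge0.
Qed.

(** The squared multiplier bound may grow like [s^-6], because [sqrt rho] is of order [s^3]; the
    factor [s^10] of the lower variance outweighs it. *)
Lemma scaled_multiplier_bound_le : (b * s + Gf / (2 * (t * s ^+ 3))) ^+ 2 * s ^+ 10 <=
  scaled_multiplier_bound * s ^+ 2.
Proof.
have -> : (b * s + Gf / (2 * (t * s ^+ 3))) ^+ 2 * s ^+ 10 =
    (b * s ^+ 4 + Gf / (2 * t)) ^+ 2 * s ^+ 4.
  by field; rewrite s0 t0.
have h : 0 <= Gf / (2 * t) by rewrite divr_ge0 // mulr_ge0 // ltW.
have s4 : 0 <= s ^+ 4 by rewrite exprn_ge0 // ltW.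
have bs4 : 0 <= b * s ^+ 4 by rewrite mulr_ge0 // ltW.
apply: ler_pM => //; [exact: sqr_ge0| |exact: pow_le].
rewrite /scaled_multiplier_bound ler_sqr ?nnegrE ?addr_ge0 // ?(ltW b_gt0) //.
by rewrite lerD2r ger_pMr // exprn_ile1 // ltW.
Qed.

End scaled_bounds.

(** * Counting iterations and oracle calls *)

Section complexity.
Context {R : realType}.
Variables (a b r cf cg : R) (eta beta rho : nat -> R) (Bf Bg : nat -> nat).
Hypotheses (a_gt0 : 0 < a) (cf_gt0 : 0 < cf) (cg_gt0 : 0 < cg).
Hypothesis schedule : sdbgd_schedule a b r cf cg eta beta rho Bf Bg.

Let etaE K : (1 <= K)%N -> eta K = a * scale K.
Proof. by move=> K1; rewrite (eta_propto schedule K1). Qed.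

Lemma upper_batch_size K : (1 <= K)%N ->
  eta K ^+ 4 * K%:R ^+ 2 = a ^+ 4 * scale K ^- 4.
Proof.
move=> K1; rewrite etaE // scaleN4 //; field.
by rewrite gt_eqF // scale_gt0.
Qed.

Lemma lower_batch_size K : (1 <= K)%N ->
  eta K ^+ 6 * K%:R ^+ 4 = a ^+ 6 * scale K ^- 10.
Proof.
move=> K1; rewrite etaE // scaleN4 //; field.
by rewrite gt_eqF // scale_gt0.
Qed.

Let invs_ge1 K n : (1 <= K)%N -> 1 <= (scale K : R) ^- n.
Proof.
move=> K1; rewrite -exprVn exprn_ege1 // invf_ge1 ?scale_gt0 //.
exact: scale_le1.
Qed.

Lemma upper_calls_le K : (1 <= K)%N ->
  (K * Bf K)%:R <= (cf * a ^+ 4 + 1) * (scale K : R) ^- 8.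
Proof.
move=> K1; have := batch_propto_le (Bf_propto schedule K1).
rewrite upper_batch_size // natrM => BfK.
have s4 : 0 <= (scale K : R) ^- 4 by rewrite (le_trans ler01) // invs_ge1.
rewrite (scaleN4 (R := R) K1); apply: le_trans (ler_wpM2l s4 BfK) _.
have -> : (scale K : R) ^- 8 = scale K ^- 4 * scale K ^- 4.
  by rewrite -!exprVn -exprD.
have := ler_wpM2l s4 (invs_ge1 4 K1).
by lra.
Qed.

Lemma lower_calls_le K : (1 <= K)%N ->
  (K * Bg K)%:R <= (cg * a ^+ 6 + 1) * (scale K : R) ^- 14.
Proof.
move=> K1; have := batch_propto_le (Bg_propto schedule K1).
rewrite lower_batch_size // natrM => BgK.
have s4 : 0 <= (scale K : R) ^- 4 by rewrite (le_trans ler01) // invs_ge1.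
rewrite (scaleN4 (R := R) K1); apply: le_trans (ler_wpM2l s4 BgK) _.
have -> : (scale K : R) ^- 14 = scale K ^- 4 * scale K ^- 10.
  by rewrite -!exprVn -exprD.
have := ler_wpM2l s4 (invs_ge1 10 K1).
by lra.
Qed.

(** With K of order [eps^-2], the calls [s^-8 = K^2] and [s^-14 = K^(7/2)] become [eps^-4] and
    [eps^-7]. *)
Lemma sdbgd_complexity_of_rate (S : R -> nat -> Prop) (C : R) (K0 : nat) :
  (forall eps K, 0 < eps -> (K0 <= K)%N -> (1 <= K)%N ->
     (C / eps) ^+ 2 <= K%:R -> S eps K) ->
  sdbgd_complexity Bf Bg S.
Proof.
(* The successor compensates truncation and makes the horizon positive. For [eps <= 1], [M * eps^-2]
   absorbs the additive constants. *)
move=> rate; pose Keps eps := (K0 + Num.truncn ((C / eps) ^+ 2)).+1.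
pose M : R := K0%:R + 1 + C ^+ 2.
have M1 : 1 <= M by have := sqr_ge0 C; have := ler0n R K0; rewrite /M; lra.
have M0 : 0 <= M by exact: le_trans M1.
have Kle eps : 0 < eps -> eps <= 1 -> (Keps eps)%:R <= M * eps ^- 2.
  move=> e0 e1; have e2 : 1 <= eps ^- 2.
    by rewrite -exprVn exprn_ege1 // invf_ge1.
  have tr : (Num.truncn ((C / eps) ^+ 2))%:R <= C ^+ 2 * eps ^- 2.
    by rewrite -exprVn -exprMn truncn_le sqr_ge0.
  rewrite /Keps -natr1 natrD.
  have : (K0%:R + 1) * 1 <= (K0%:R + 1) * eps ^- 2.
    by rewrite ler_wpM2l // addr_ge0.
  by rewrite /M; lra.
have sumE (n m : nat) : (\sum_(k < n) m = n * m)%N by rewrite sum_nat_const card_ord.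
exists Keps; split.
- move=> eps e0; split => // K KK; have K1 : (1 <= K)%N by exact: leq_trans KK.
  apply: rate => //; first by rewrite (leq_trans _ KK) // /Keps -addnS leq_addr.
  apply/ltW/(lt_le_trans (truncnS_gt _)); rewrite ler_nat.
  by rewrite (leq_trans _ KK) // /Keps -addnS leq_addl.
- apply/eqO_exP; exists M; first exact: lt_le_trans M1.
  near=> eps.
  have e0 : 0 < eps by near: eps; exact: nbhs_right_gt.
  have e1 : eps <= 1 by near: eps; exact: nbhs_right_le.
  rewrite ger0_norm // ger0_norm ?invr_ge0 ?exprn_ge0 ?(ltW e0) //.
  exact: Kle.
- apply/eqO_exP; exists ((cf * a ^+ 4 + 1) * M ^+ 2).
    rewrite mulr_gt0 ?exprn_gt0 ?(lt_le_trans _ M1) // ltr_wpDl //.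
    by rewrite mulr_ge0 ?exprn_ge0 // ltW.
  near=> eps.
  have e0 : 0 < eps by near: eps; exact: nbhs_right_gt.
  have e1 : eps <= 1 by near: eps; exact: nbhs_right_le.
  rewrite ger0_norm // ger0_norm ?invr_ge0 ?exprn_ge0 ?(ltW e0) //.
  rewrite sumE; apply: le_trans (upper_calls_le _) _ => //.
  rewrite -mulrA.
  rewrite ler_wpM2l ?addr_ge0 ?mulr_ge0 ?exprn_ge0 ?(ltW cf_gt0) ?(ltW a_gt0) //.
  have := Kle _ e0 e1; rewrite (scaleN4 (K := Keps eps)) // => KM.
  have -> : (scale (Keps eps) : R) ^- 8 = (scale (Keps eps) ^- 4) ^+ 2.
    by rewrite -!exprVn -exprM.
  have -> : M ^+ 2 * eps ^- 4 = (M * eps ^- 2) ^+ 2.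
    by rewrite exprMn -!exprVn -exprM.
  rewrite ler_sqr ?nnegrE ?mulr_ge0 ?invr_ge0 ?exprn_ge0 ?(ltW e0) //.
  by rewrite ltW // scale_gt0.
- apply/eqO_exP; exists ((cg * a ^+ 6 + 1) * M ^+ 7).
    rewrite mulr_gt0 ?exprn_gt0 ?(lt_le_trans _ M1) // ltr_wpDl //.
    by rewrite mulr_ge0 ?exprn_ge0 // ltW.
  near=> eps.
  have e0 : 0 < eps by near: eps; exact: nbhs_right_gt.
  have e1 : eps <= 1 by near: eps; exact: nbhs_right_le.
  rewrite ger0_norm // ger0_norm ?invr_ge0 ?exprn_ge0 ?(ltW e0) //.
  rewrite sumE; apply: le_trans (lower_calls_le _) _ => //.
  rewrite -mulrA.
  rewrite ler_wpM2l ?addr_ge0 ?mulr_ge0 ?exprn_ge0 ?(ltW cg_gt0) ?(ltW a_gt0) //.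
  have := Kle _ e0 e1; rewrite (scaleN4 (K := Keps eps)) // => KM.
  have s0 : 0 <= (scale (Keps eps) : R) ^- 2.
    by rewrite invr_ge0 exprn_ge0 // ltW // scale_gt0.
  have Me : 0 <= M / eps by rewrite divr_ge0 // ltW.
  (* The half-integer power of K is a seventh power of [s^-2 = sqrt K]; [M >= 1] allows [M] in place
     of its square root. *)
  have sM : (scale (Keps eps) : R) ^- 2 <= M / eps.
    rewrite -ler_sqr ?nnegrE // -!exprVn -exprM exprVn; apply: le_trans KM _.
    rewrite exprMn exprVn ler_wpM2r ?invr_ge0 ?exprn_ge0 ?(ltW e0) //.
    by rewrite expr2 ler_peMr.
  have -> : (scale (Keps eps) : R) ^- 14 = (scale (Keps eps) ^- 2) ^+ 7.
    by rewrite -!exprVn -exprM.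
  have -> : M ^+ 7 * eps ^- 7 = (M / eps) ^+ 7 by rewrite exprMn exprVn.
  by rewrite lerXn2r ?nnegrE.
Unshelve. all: by end_near. Qed.

End complexity.

(** * From expectation to probability *)

Section markov.
Context {R : realType} d (Om : measurableType d) (P : probability Om R).

Lemma measurable_superlevel (h : Om -> R) (eps : R) :
  measurable_fun setT h -> measurable [set w | eps < h w].
Proof.
move=> mh; have -> : [set w | eps < h w] = h @^-1` `]eps, +oo[.
  by apply/seteqP; split => w /=; rewrite in_itv /= andbT.
by rewrite -[X in measurable X]setTI; exact: mh.
Qed.

Lemma probability_gt_le (h : Om -> R) (m eps : R) :
  measurable_fun setT h -> (forall w, 0 <= h w) -> 0 < eps ->
  (\int[P]_w (h w)%:E <= (m * eps)%:E)%E ->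
  (P [set w | (eps < h w)%R] <= m%:E)%E.
Proof.
move=> mh h0 e0 hm.
have mA := measurable_superlevel eps mh.
rewrite -(@lee_pmul2r _ eps%:E) ?lte_fin // -EFinM; apply: le_trans hm.
rewrite muleC -integral_cst //.
apply: (@le_trans _ _ (\int[P]_(w in [set w | (eps < h w)%R]) (h w)%:E)%E).
  apply: ge0_le_integral => //.
  - by move=> w _; rewrite lee_fin ltW.
  - by apply/measurable_EFinP; exact: measurable_funS mh.
  - by move=> w /= /ltW; rewrite lee_fin.
apply: ge0_subset_integral => //; first exact/measurable_EFinP.
by move=> w _; rewrite lee_fin.
Qed.

End markov.

Section mean_to_probability.
Context {R : realType} {H : completeNormedModType R}.
Variables (df dg : H -> H).

(** Common source of both conclusions: it carries the measurability that Markov's inequality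
    needs. *)
Definition measurably_stationary_in_mean (eps : R) d (Om : measurableType d)
    (P : probability Om R) (X : Om -> H) : Prop :=
  exists lam : Om -> R, [/\ measurable_fun setT lam, forall w, 0 <= lam w,
    measurable_fun setT (fun w => `|df (X w) + lam w *: dg (X w)| ^+ 2) /\
    measurable_fun setT (fun w => `|dg (X w)| ^+ 2),
    (\int[P]_w (`|df (X w) + lam w *: dg (X w)| ^+ 2)%:E <= eps%:E)%E
    & (\int[P]_w (`|dg (X w)| ^+ 2)%:E <= eps%:E)%E].

Lemma measurably_stationary_mean eps d (Om : measurableType d)
    (P : probability Om R) (X : Om -> H) :
  measurably_stationary_in_mean eps P X ->
  stationary_in_mean df dg eps eps P X.
Proof.
move=> [lam [mlam lam0 _ b1 b2]].
pose lam' : {mfun Om >-> R} :=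
  HB.pack lam (isMeasurableFun.Build _ _ _ _ _ mlam).
by exists lam'; split => //; rewrite expectation.unlock.
Qed.

(** Markov's inequality for each of the two criteria, each failing with probability at most
    [(1 - p) / 2], then a union bound. *)
Lemma measurably_stationary_probability (p eps : R) d (Om : measurableType d)
    (P : probability Om R) (X : Om -> H) : p < 1 -> 0 < eps ->
  measurably_stationary_in_mean ((1 - p) / 2 * eps) P X ->
  stationary_with_probability df dg p eps eps P X.
Proof.
move=> p1 e0 [lam [mlam lam0 [m1 m2] b1 b2]].
pose A1 := [set w | eps < `|df (X w) + lam w *: dg (X w)| ^+ 2].
pose A2 := [set w | eps < `|dg (X w)| ^+ 2].
have mA1 : measurable A1 := measurable_superlevel eps m1.
have mA2 : measurable A2 := measurable_superlevel eps m2.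
have PA1 : (P A1 <= ((1 - p) / 2)%:E)%E.
  by apply: probability_gt_le b1 => // w; exact: sqr_ge0.
have PA2 : (P A2 <= ((1 - p) / 2)%:E)%E.
  by apply: probability_gt_le b2 => // w; exact: sqr_ge0.
exists (~` (A1 `|` A2)); split.
- by apply: measurableC; exact: measurableU.
- have PU : (P (A1 `|` A2) <= (1 - p)%:E)%E.
    apply: le_trans (measureU2 _ _ _) _ => //.
    have -> : (1 - p)%:E = (((1 - p) / 2)%:E + ((1 - p) / 2)%:E)%E.
      by rewrite -EFinD; congr (_%:E); lra.
    exact: leeD.
  rewrite probability_setC; last exact: measurableU.
  have : P (A1 `|` A2) \is a fin_num by rewrite fin_num_measure //; exact: measurableU.
  move: PU; case: (P _) => // q; rewrite !lee_fin; lra.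
- move=> w /= /not_orP[/negP nA1 /negP nA2]; exists (lam w); split => //.
    by rewrite leNgt.
  by rewrite leNgt.
Qed.

End mean_to_probability.

(** * The rate with explicit constants *)

Section rate.
Context {R : realType} {H : completeNormedModType R} (ip : {dot H for idfun}).
Hypothesis ip_norm : forall x : H, ip x x = `|x| ^+ 2.
Context dX dZ (Xi : measurableType dX) (Zt : measurableType dZ)
  (PXi : probability Xi R) (PZt : probability Zt R).
Variables (F : Xi -> H -> R) (dF : Xi -> H -> H) (f : H -> R) (df : H -> H)
  (G : Zt -> H -> R) (dG : Zt -> H -> H) (g : H -> R) (dg : H -> H)
  (Lf Lg Gf sigma2f sigma2g : R).
Hypotheses (Lf_gt0 : 0 < Lf) (Lg_gt0 : 0 < Lg)
  (sigma2f_ge0 : 0 <= sigma2f) (sigma2g_ge0 : 0 <= sigma2g).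
Hypothesis upper : smooth_stochastic_objective ip PXi F dF f df Lf sigma2f.
Hypothesis lower : smooth_stochastic_objective ip PZt G dG g dg Lg sigma2g.
Hypothesis argmin_g : argmin g !=set0.
Hypothesis inf_f : has_lbound (range f).
Hypothesis df_bounded : forall x, `|df x| <= Gf.
Variables (x0 : H) (a b r cf cg : R).
Hypotheses (a_gt0 : 0 < a) (b_gt0 : 0 < b) (r_gt0 : 0 < r)
  (cf_gt0 : 0 < cf) (cg_gt0 : 0 < cg).
Variables (eta beta rho : nat -> R) (Bf Bg : nat -> nat).
Hypothesis schedule : sdbgd_schedule a b r cf cg eta beta rho Bf Bg.
Hypothesis eta_range : forall K, (1 <= K)%N ->
  0 < eta K < (2 * Lf + 4 * Lg)^-1.

Lemma sdbgd_rate : exists (C : R) (K0 : nat), forall (eps : R) (K : nat),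
  0 < eps -> (K0 <= K)%N -> (1 <= K)%N -> (C / eps) ^+ 2 <= K%:R ->
  forall (d : measure_display) (Om : measurableType d) (P : probability Om R)
    (xi : nat -> nat -> {RV P >-> Xi}) (zeta : nat -> nat -> {RV P >-> Zt})
    (N : {RV P >-> nat}),
  sdbgd_sampling PXi PZt K (fun=> eta K) (fun=> beta K)
    (fun=> Bf K) (fun=> Bg K) xi zeta N ->
  measurably_stationary_in_mean df dg eps P (fun w => sdbgd ip dF dG x0
    (fun=> eta K) (fun=> beta K) (fun=> rho K) (fun=> Bf K) (fun=> Bg K)
    (fun k i => xi k i w) (fun k j => zeta k j w) (N w)).
Proof.
(* The value of g at a minimizer serves as its lower bound. *)
have [xg xgP] := argmin_g; have [mf mfP] := inf_f.
have mf_le x : mf <= f x by apply: mfP; exists x.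
have Gf0 : 0 <= Gf by exact: le_trans (normr_ge0 _) (df_bounded x0).
(* With [s = scale K] and [eta = a s], the schedule reads [beta = b' s] and [rho = (t' s^3)^2]. *)
pose b' := b / a ^+ 3; pose t' := Num.sqrt r / a.
(* Equality in [c * Lg * eta <= beta / 4], simultaneously for all K. *)
pose c := b' / (4 * Lg * a).
have b'0 : 0 < b' by rewrite divr_gt0 // exprn_gt0.
have t'0 : 0 < t' by rewrite divr_gt0 // sqrtr_gt0.
have c0 : 0 < c by rewrite divr_gt0 // !mulr_gt0.
(* The condition [beta^2 <= c / 4] reads [s^2 <= q], that is [K >= q^-2], which dictates the
   threshold chosen below. *)
pose q := c / (4 * b' ^+ 2).
have q0 : 0 < q by rewrite divr_gt0 // mulr_gt0 // exprn_gt0.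
(* Chosen so that [1 / Bf <= C1 s^4] and [1 / Bg <= C2 s^10], by [batch_propto_inv]. *)
pose C1 := 2 / (cf * a ^+ 4); pose C2 := 2 / (cg * a ^+ 6).
have C10 : 0 < C1 by rewrite divr_gt0 // mulr_gt0 // exprn_gt0.
have C20 : 0 < C2 by rewrite divr_gt0 // mulr_gt0 // exprn_gt0.
pose M0 := scaled_bias f g x0 mf (g xg) Gf a b' t' c.
pose M1 := scaled_upper_noise b' t' c; pose M2 := scaled_lower_noise b' c.
pose M3 := scaled_multiplier_bound Gf b' t'.
pose S1 := sigma2f * C1; pose S2 := sigma2g * C2.
have S10 : 0 <= S1 by rewrite mulr_ge0 // ltW.
have S20 : 0 <= S2 by rewrite mulr_ge0 // ltW.
have h2 : 0 <= 2 * b' ^+ 2 / c.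
  by rewrite divr_ge0 ?(ltW c0) // mulr_ge0 // sqr_ge0.
have h3 : 0 <= c * (t' / (2 * b')) by rewrite ltW // mulr_gt0 // divr_gt0 // mulr_gt0.
have M00 : 0 <= M0.
  have h4 : 0 <= (f x0 - mf) / a by rewrite divr_ge0 ?subr_ge0 // ltW.
  have h5 : 0 <= c * ((g x0 - g xg) / (a * b')).
    by rewrite mulr_ge0 ?(ltW c0) // divr_ge0 ?subr_ge0 // ltW // mulr_gt0.
  have h6 : 0 <= c * t' ^+ 2 by rewrite mulr_ge0 ?sqr_ge0 // ltW.
  have h7 : 0 <= 2 * b' ^+ 2 / c * Gf ^+ 2 by rewrite mulr_ge0 ?sqr_ge0.
  have h8 : 0 <= c * (t' / (2 * b')) * (Gf + 1) by rewrite mulr_ge0 // addr_ge0.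
  by rewrite /M0 /scaled_bias; lra.
have M10 : 0 <= M1 by rewrite /M1 /scaled_upper_noise; lra.
have M20 : 0 <= M2 by rewrite divr_ge0 ?sqr_ge0 // mulr_ge0 // sqr_ge0.
have M30 : 0 <= M3 by exact: sqr_ge0.
(* [Cs] and [Cl] are the factors of [s^2] in the two stationarity bounds; their sum serves for
   both. *)
pose Cs := 8 * M0 + (8 * M1 + 12) * S1 + (8 * M2 + 3 * M3) * S2.
pose Cl := 4 / c * M0 + 4 / c * M1 * S1 + (4 / c * M2 + 2) * S2.
have c40 : 0 <= 4 / c by rewrite divr_ge0 // ltW.
have Cs0 : 0 <= Cs.
  by rewrite !addr_ge0 // mulr_ge0 // addr_ge0 // mulr_ge0.
have Cl0 : 0 <= Cl.
  rewrite /Cl; apply: addr_ge0; last by rewrite mulr_ge0 // addr_ge0 // mulr_ge0.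
  by rewrite addr_ge0 ?(mulr_ge0 (mulr_ge0 c40 M10)) // mulr_ge0.
exists (Cs + Cl), (Num.truncn (q ^- 2)).+1 => eps K e0 K0K K1 CK.
move=> d Om P xi zeta N sampling.
have s0 : 0 < scale K :> R by exact: scale_gt0.
have s1 : scale K <= 1 :> R by exact: scale_le1.
have KE : K%:R = (scale K : R) ^- 4 by exact: scaleN4.
have etaE : eta K = a * scale K by rewrite (eta_propto schedule K1).
have betaE : beta K = b' * scale K.
  rewrite (beta_propto schedule K1) etaE -scaleX4 // /b'; field.
  by rewrite !gt_eqF.
have rhoE : rho K = (t' * scale K ^+ 3) ^+ 2.
  have t2 : t' ^+ 2 = r / a ^+ 2.
    by rewrite /t' exprMn exprVn sqr_sqrtr // ltW.
  rewrite (rho_propto schedule K1) etaE KE [RHS]exprMn t2.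
  by field; rewrite !gt_eqF.
have [Bf1 _] := Bf_propto schedule K1; have [Bg1 _] := Bg_propto schedule K1.
have sfle : sigma2f / (Bf K)%:R <= S1 * scale K ^+ 4.
  rewrite /S1 -mulrA ler_wpM2l //.
  have y0 : 0 < a ^+ 4 * (scale K : R) ^- 4.
    by rewrite mulr_gt0 ?invr_gt0 ?exprn_gt0.
  have := batch_propto_inv cf_gt0 y0.
  rewrite -(upper_batch_size schedule K1) => /(_ _ (Bf_propto schedule K1)).
  rewrite (upper_batch_size schedule K1) => /le_trans; apply.
  rewrite /C1 le_eqVlt; apply/orP; left; apply/eqP.
  by field; rewrite !gt_eqF.
have sgle : sigma2g / (Bg K)%:R <= S2 * scale K ^+ 10.
  rewrite /S2 -mulrA ler_wpM2l //.
  have y0 : 0 < a ^+ 6 * (scale K : R) ^- 10.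
    by rewrite mulr_gt0 ?invr_gt0 ?exprn_gt0.
  have := batch_propto_inv cg_gt0 y0.
  rewrite -(lower_batch_size schedule K1) => /(_ _ (Bg_propto schedule K1)).
  rewrite (lower_batch_size schedule K1) => /le_trans; apply.
  rewrite /C2 le_eqVlt; apply/orP; left; apply/eqP.
  by field; rewrite !gt_eqF.
have Ceps : (Cs + Cl) * scale K ^+ 2 <= eps.
  have sq0 : 0 <= (scale K : R) ^+ 2 by exact: sqr_ge0.
  have C0 : 0 <= Cs + Cl by exact: addr_ge0.
  rewrite -ler_sqr ?nnegrE ?(mulr_ge0 C0 sq0) ?(ltW e0) //.
  rewrite exprMn -exprM scaleX4 // ler_pdivrMr ?ltr0n // mulrC.
  by rewrite -ler_pdivrMr ?exprn_gt0 // -exprVn -exprMn.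
have eta_le : Lf * eta K <= 2^-1.
  have /andP[eta0] := eta_range K1.
  rewrite -[X in _ < X]div1r ltr_pdivlMr ?addr_gt0 ?mulr_gt0 // => etaD.
  by have := mulr_gt0 eta0 Lg_gt0; lra.
have c_le : c * Lg * eta K <= beta K / 4.
  rewrite betaE etaE /c le_eqVlt; apply/orP; left; apply/eqP.
  by field; rewrite !gt_eqF.
have beta_le : beta K ^+ 2 <= c / 4.
  have sq : (scale K : R) ^+ 2 <= q.
    rewrite -ler_sqr ?nnegrE ?sqr_ge0 ?(ltW q0) // -exprM scaleX4 //.
    rewrite -[q ^+ 2]invrK lef_pV2 ?posrE ?invr_gt0 ?exprn_gt0 ?ltr0n //.
    by rewrite (le_trans (ltW (truncnS_gt _))) // ler_nat.
  rewrite betaE exprMn.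
  have <- : b' ^+ 2 * q = c / 4 by rewrite /q; field; rewrite !gt_eqF.
  by rewrite ler_wpM2l ?sqr_ge0.
have t0 : 0 < t' * scale K ^+ 3 by rewrite mulr_gt0 // exprn_gt0.
have eta0 : 0 < eta K by rewrite etaE mulr_gt0.
have beta0 : 0 < beta K by rewrite betaE mulr_gt0.
have stat := expected_stationarity ip_norm upper lower mf_le xgP
  df_bounded x0 beta0 t0 eta0 c0 eta_le c_le beta_le Bf1 Bg1 K1 sampling.
have low := expected_lower_stationarity ip_norm upper lower mf_le xgP
  df_bounded x0 beta0 t0 eta0 c0 eta_le c_le beta_le Bf1 Bg1 K1 sampling.
have T0 : (initial_gap f g mf (g xg) x0 (eta K) (beta K) c
    + K%:R * bias Gf (beta K) (t' * scale K ^+ 3) c) / K%:R <= M0 * scale K ^+ 2.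
  by rewrite etaE betaE; exact: scaled_bias_le.
have T1 : upper_noise (beta K) (t' * scale K ^+ 3) c <= M1.
  by rewrite betaE; exact: scaled_upper_noise_le.
have T2 : lower_noise (beta K) c * scale K ^+ 10 <= M2 * scale K ^+ 2.
  by rewrite betaE; exact: scaled_lower_noise_le.
have T3 : (beta K + Gf / (2 * (t' * scale K ^+ 3))) ^+ 2 * scale K ^+ 10 <=
    M3 * scale K ^+ 2.
  by rewrite betaE; exact: scaled_multiplier_bound_le.
have sf0 : 0 <= sigma2f / (Bf K)%:R by rewrite divr_ge0.
have sg0 : 0 <= sigma2g / (Bg K)%:R by rewrite divr_ge0.
have al20 : 0 <= lower_noise (beta K) c.
  by rewrite divr_ge0 ?sqr_ge0 // mulr_ge0 // sqr_ge0.
have pow_le n : (2 <= n)%N -> (scale K : R) ^+ n <= scale K ^+ 2.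
  by move=> n2; apply: ler_wiXn2l => //; exact: ltW.
move: (initial_gap _ _ _ _ _ _ _ _ + _) T0 stat low => A T0 stat low.
move: (upper_noise _ _ _) (lower_noise _ _) T1 T2 al20 stat low => l1 l2 T1 T2 l20 stat low.
move: (_ ^+ 2) T3 (sqr_ge0 (beta K + Gf / (2 * (t' * scale K ^+ 3)))) stat.
move=> l3 T3 l30 stat.
move: (sigma2f / _) (sigma2g / _) sf0 sg0 sfle sgle stat low.
move=> sf sg sf0 sg0 sfle sgle stat low.
set s2 := (scale K : R) ^+ 2 in T0 T2 T3 Ceps pow_le.
have s20 : 0 <= s2 by exact: sqr_ge0.
have sf2 : sf <= S1 * s2 by rewrite (le_trans sfle) // ler_wpM2l // pow_le.
have sg2 : sg <= S2 * s2 by rewrite (le_trans sgle) // ler_wpM2l // pow_le.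
have X1 : l1 * sf <= M1 * (S1 * s2).
  by apply: le_trans (ler_wpM2r sf0 T1) _; exact: ler_wpM2l.
(* The coefficients [l2] and [l3] may grow with K, so they are paired with the full [s^10] before it
   is weakened to [s^2]. *)
have X2 : l2 * sg <= S2 * (M2 * s2).
  by apply: le_trans (ler_wpM2l l20 sgle) _; rewrite mulrCA ler_wpM2l.
have X3 : l3 * sg <= S2 * (M3 * s2).
  by apply: le_trans (ler_wpM2l l30 sgle) _; rewrite mulrCA ler_wpM2l.
have Cs2 : 0 <= Cs * s2 by rewrite mulr_ge0.
have Cl2 : 0 <= Cl * s2 by rewrite mulr_ge0.
rewrite rhoE; exists (fun w => shadow_multiplier ip dF df dG x0 (eta K) (beta K)
  (t' * scale K ^+ 3) (Bf K) (Bg K) xi zeta (N w) w); split.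
- exact: (measurable_random_shadow_multiplier ip_norm upper lower).
- by move=> w; exact: multiplier_ge0.
- split; first exact: (measurable_random_stationarity ip_norm upper lower).
  exact: (measurable_random_lower_stationarity ip_norm upper lower).
- apply: le_trans stat _; rewrite lee_fin; apply: le_trans Ceps.
  by move: Cl2; rewrite /Cs; lra.
- apply: le_trans low _; rewrite lee_fin; apply: le_trans Ceps.
  have Y0 := ler_wpM2l c40 T0; have Y1 := ler_wpM2l c40 X1.
  have Y2 := ler_wpM2l c40 X2.
  by move: Cs2; rewrite /Cl; lra.
Qed.

End rate.

Theorem mainTheorem2 (R : realType)
  (* the Hilbert space *)
  (H : completeNormedModType R) (ip : {dot H for idfun})
  (ip_norm : forall x : H, ip x x = `|x| ^+ 2)
  (* the problem *)
  (dX dZ : measure_display)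
  (Xi : measurableType dX) (PXi : probability Xi R)
  (Zt : measurableType dZ) (PZt : probability Zt R)
  (F : Xi -> H -> R) (dF : Xi -> H -> H) (f : H -> R) (df : H -> H)
  (G : Zt -> H -> R) (dG : Zt -> H -> H) (g : H -> R) (dg : H -> H)
  (Lf Lg Gf sigma2f sigma2g : R)
  (Lf_gt0 : 0 < Lf) (Lg_gt0 : 0 < Lg) (Gf_gt0 : 0 < Gf)
  (sigma2f_ge0 : 0 <= sigma2f) (sigma2g_ge0 : 0 <= sigma2g)
  (upper : smooth_stochastic_objective ip PXi F dF f df Lf sigma2f)
  (lower : smooth_stochastic_objective ip PZt G dG g dg Lg sigma2g)
  (argmin_g : argmin g !=set0) (inf_f : has_lbound (range f))
  (df_bounded : forall x, `|df x| <= Gf)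
  (* the schedule, indexed by the horizon *)
  (x0 : H) (a b r cf cg : R)
  (a_gt0 : 0 < a) (b_gt0 : 0 < b) (r_gt0 : 0 < r)
  (cf_gt0 : 0 < cf) (cg_gt0 : 0 < cg)
  (eta beta rho : nat -> R) (Bf Bg : nat -> nat)
  (schedule : sdbgd_schedule a b r cf cg eta beta rho Bf Bg)
  (eta_range : forall K, (1 <= K)%N ->
     0 < eta K < (2 * Lf + 4 * Lg)^-1)
  (beta_range : forall K, (1 <= K)%N -> 0 < beta K < 1) :
  let on_every_run (K : nat) (S : forall (d : measure_display)
        (Om : measurableType d) (P : probability Om R), (Om -> H) -> Prop) :=
    forall (d : measure_display) (Om : measurableType d)
      (P : probability Om R)
      (xi : nat -> nat -> {RV P >-> Xi}) (zeta : nat -> nat -> {RV P >-> Zt})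
      (N : {RV P >-> nat}),
    sdbgd_sampling PXi PZt K (fun=> eta K) (fun=> beta K)
      (fun=> Bf K) (fun=> Bg K) xi zeta N ->
    S d Om P (fun w => sdbgd ip dF dG x0
      (fun=> eta K) (fun=> beta K) (fun=> rho K) (fun=> Bf K) (fun=> Bg K)
      (fun k i => xi k i w) (fun k j => zeta k j w) (N w)) in
  sdbgd_complexity Bf Bg (fun eps K => on_every_run K
    (fun d Om P X => stationary_in_mean df dg eps eps P X)) /\
  (forall p : R, p < 1 -> sdbgd_complexity Bf Bg (fun eps K => on_every_run K
    (fun d Om P X => stationary_with_probability df dg p eps eps P X))).
Proof.
move=> on_every_run.
have [C [K0 rate]] := sdbgd_rate ip_norm Lf_gt0 Lg_gt0 sigma2f_ge0 sigma2g_ge0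
  upper lower argmin_g inf_f df_bounded x0 a_gt0 b_gt0 r_gt0 cf_gt0 cg_gt0
  schedule eta_range.
split.
  apply: (sdbgd_complexity_of_rate a_gt0 cf_gt0 cg_gt0 schedule
    (C := C) (K0 := K0)) => eps K e0 K0K K1 CK d Om P xi zeta N sampling.
  by apply: measurably_stationary_mean; exact: rate.
move=> p p1.
have p0 : 0 < (1 - p) / 2 by rewrite divr_gt0 // subr_gt0.
(* The mean accuracy required is [(1 - p) / 2 * eps], which only rescales the constant and leaves
   the powers of [eps] unchanged. *)
apply: (sdbgd_complexity_of_rate a_gt0 cf_gt0 cg_gt0 schedule
  (C := C / ((1 - p) / 2)) (K0 := K0)) => eps K e0 K0K K1 CK d Om P xi zeta N sampling.
apply: measurably_stationary_probability => //.
apply: rate => //; first exact: mulr_gt0.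
by rewrite invfM mulrA.
Qed.
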